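(* Suppose that Assumptions A, B, C, D and E listed in the context hold. Then for every $\epsilon>0$, with $U^c=\{\theta\in\Theta:\sup_{x\in\mathcal{X}}|\theta(x)-\theta^*(x)|>\epsilon\}$, $$\Pi(U^c\mid Y_{1:n})\to0\quad\text{as }n\to\infty,\qquad\mathsf{P}_0\text{-almost surely}.$$
   Context: Setting (independent, non-identically distributed responses). $\mathcal{X}$ is a covariate space; for each $x\in\mathcal{X}$, $f_{0x}$ is a ''true'' probability density (with respect to a $\sigma$-finite measure), and $\mathsf{E}_x$ is expectation of a response $Y\sim f_{0x}$. A fixed (non-random) design $x_1,x_2,\dots\in\mathcal{X}$ is given and $Y_1,Y_2,\dots$ are independent with $Y_i\sim f_{0x_i}$; $\mathsf{P}_0,\mathsf{E}_0$ refer to the infinite product measure. $\{f_t:t\in[-M,M]\}$ is a family of densities, $\Theta$ is a class of continuous functions $\mathcal{X}\to[-M,M]$, $\theta_x$ denotes $\theta(x)$, and the specified model is $Y_i\sim f_{\theta_{x_i}}$, $\theta\in\Theta$. $\Pi$ is a prior (probability measure) on $\Theta$, with the usual measurability understood. The posterior is $$\Pi(A\mid Y_{1:n})=\frac{\int_A\prod_{i=1}^n\frac{f_{\theta_{x_i}}(Y_i)}{f_{\theta^*_{x_i}}(Y_i)}d\Pi(\theta)}{\int_\Theta\prod_{i=1}^n\frac{f_{\theta_{x_i}}(Y_i)}{f_{\theta^*_{x_i}}(Y_i)}d\Pi(\theta)},$$ where $\theta^*$ is as in Assumption C. Assumption A: $\mathcal{X}$ is compact with respect to a norm $\|\cdot\|$,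 and $\Theta$ is a compact subset of the continuous functions on $\mathcal{X}$ with the sup-norm metric $d(\theta_1,\theta_2)=\sup_{x\in\mathcal{X}}|\theta_1(x)-\theta_2(x)|$. Assumption B: for every $x_0\in\mathcal{X}$ and $\delta'>0$, with $A_{x_0,\delta'}=\{x:\|x-x_0\|<\delta'\}$, $\kappa(x_0,\delta')=\liminf_{n}\frac1n\sum_{i=1}^n I_{A_{x_0,\delta'}}(x_i)>0$. Assumption C: there exists $\theta^*\in\Theta$ with $\theta^*_x=\arg\min_{t\in[-M,M]}\mathsf{E}_x\log\frac{f_{0x}}{f_t}$ for all $x\in\mathcal{X}$, and $\theta^*$ is in the sup-norm support of $\Pi$ (every sup-norm neighborhood of $\theta^*$ has positive $\Pi$-probability). Assumption D: $\mathsf{E}_x\left[\log\frac{f_t}{f_{t'}}\right]$ and, for every $\alpha\in[0,1]$, $\mathsf{E}_x\left[\left(\frac{f_t}{f_{t'}}\right)^\alpha\right]$ are continuous functions of $(x,t,t')\in\mathcal{X}\times[-M,M]^2$, and $\mathsf{E}_x\log^2\frac{f_t}{f_{t'}}$ is uniformly bounded over $(x,t,t')\in\mathcal{X}\times[-M,M]^2$. Assumption E: for every $\epsilon>0$ there is $\delta\in(0,1)$ such that for all $x\in\mathcal{X}$, $\{t\in[-M,M]:\mathsf{E}_x\log\frac{f_{\theta^*_x}}{f_t}<\delta\}\subseteq\{t:|t-\theta^*_x|<\epsilon\}$. *)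

(* Defs.v *)
From HB Require Import structures.
From mathcomp Require Export all_boot all_order all_algebra.
From mathcomp Require Export finmap.
From mathcomp Require Export all_classical all_reals all_analysis.
Export Order.TTheory GRing.Theory Num.Theory.
Export numFieldNormedType.Exports.

Set Implicit Arguments.
Unset Strict Implicit.
Unset Printing Implicit Defensive.

Local Open Scope classical_set_scope.
Local Open Scope ring_scope.

(* The covariate space is a subset X of a normed space V.  Used as a type, X
   carries the topology induced by the norm. *)

(* Real functions on X with the topology of the sup-norm metric and its Borel
   sigma-algebra; see nbhs_supdist for the agreement with supdist. *)
Definition paramType (R : realType) (V : normedModType R) (X : set V) :=
  g_sigma_algebraType (@open {uniform X -> R}).

Definition supdist (R : realType) (T : Type) (th1 th2 : T -> R) : R :=
  sup [set `|th1 x - th2 x| | x in [set: T]].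

Lemma nbhs_supdist (R : realType) (V : normedModType R) (X : set V)
    (x0 : X) (th : {uniform X -> R}) (A : set (X -> R)) :
  nbhs th A <->
  exists2 e : R, 0 < e &
    [set th' : X -> R | has_ubound [set `|th x - th' x| | x in [set: X]] /\
                        supdist th th' < e] `<=` A.
Proof.
rewrite uniform_nbhs; split.
- move=> [E [+ EA]] => /= entE.
  have [e /= e0 eE] : exists2 e : R, 0 < e &
      [set xy : R * R | ball xy.1 e xy.2] `<=` E.
    by move: entE; rewrite -entourage_from_ballE => -[e /= e0 eE]; exists e.
  exists e => // th' [/= ub lte]; apply: EA => y _; apply: eE => /=.
  rewrite -ball_normE /=; apply: le_lt_trans lte.
  by apply: ub_le_sup => //; exists y.
- move=> [e e0 eA]; exists [set xy : R * R | ball xy.1 (e / 2) xy.2]; split.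
    by rewrite -entourage_from_ballE; exists (e / 2) => //=; rewrite divr_gt0.
  move=> th' /= close; apply: eA => /=.
  have ub : ubound [set `|th x - th' x| | x in [set: X]] (e / 2).
    by move=> _ [x _ <-]; have := close x Logic.I; rewrite -ball_normE => /ltW.
  split; first by exists (e / 2).
  apply: (@le_lt_trans _ _ (e / 2)); last by rewrite ltr_pdivrMr// mulr2n mulrDr mulr1 ltrDl.
  by apply: ge_sup => //; exists `|th x0 - th' x0|, x0.
Qed.

Section model.
Context (R : realType) (V : normedModType R) (X : set V).
Context (d : measure_display) (S : measurableType d).
Context (mu : {sigma_finite_measure set S -> \bar R}).

Definition is_density (p : S -> R) : Prop :=
  [/\ measurable_fun setT p, forall y, 0 <= p y
    & (\int[mu]_y (p y)%:E = 1)%E].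

(* In \bar R, a / 0 = +oo for 0 < a, 0 / 0 = 0, ln 0 = -oo and ln +oo = +oo.
   Hence finiteness of E_x [log (f_t / f_t)] already forces f_t > 0 almost
   surely under f_0x. *)
Definition lratio (p q : S -> R) (y : S) : \bar R := ((p y)%:E / (q y)%:E)%E.

Definition llratio (p q : S -> R) (y : S) : \bar R := lne (lratio p q y).

Variables (f0 : X -> S -> R) (M : R) (f : R -> S -> R).

(* E_x *)
Definition Ex (x : X) (g : S -> \bar R) : \bar R :=
  (\int[mu]_y (g y * (f0 x y)%:E))%E.

(* Joint measurability of (t, y) |-> f_t(y) is what makes the integrals over
   the parameter space and Fubini's theorem meaningful. *)
Definition density_model : Prop :=
  [/\ forall x, is_density (f0 x),
      forall t, t \in `[- M, M] -> is_density (f t)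
    & measurable_fun ([set t : R | t \in `[- M, M]] `*` [set: S])
        (fun z : R * S => f z.1 z.2)].

(* Theta is a class of continuous functions X -> [-M, M]. *)
Definition param_class (Theta : set (paramType X)) : Prop :=
  forall th : X -> R, Theta th ->
    continuous th /\ forall x, th x \in `[- M, M].

Definition assumptionA (Theta : set (paramType X)) : Prop :=
  compact X /\ compact (Theta : set {uniform X -> R}).

Definition kappa (xs : nat -> X) (x0 : X) (r : R) : \bar R :=
  limn_einf (fun n =>
    (n%:R^-1 * \sum_(i < n)
      \1_([set x : X | `|set_val x - set_val x0| < r]) (xs i))%:E).

Definition assumptionB (xs : nat -> X) : Prop :=
  forall (x0 : X) (r : R), 0 < r -> (0 < kappa xs x0 r)%E.

Definition assumptionC (Theta : set (paramType X))
    (Pi : probability (paramType X) R) (thstar : X -> R) : Prop :=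
  [/\ Theta thstar,
      forall (x : X) (t : R), t \in `[- M, M] ->
        (Ex x (llratio (f0 x) (f (thstar x))) <= Ex x (llratio (f0 x) (f t)))%E
    & forall e : R, 0 < e ->
        (0 < Pi [set th : paramType X |
                  Theta th /\ (supdist th thstar < e)%R])%E].

Definition param_cube : set (X * R * R) :=
  [set z | z.1.2 \in `[- M, M] /\ z.2 \in `[- M, M]].

(* g is a finite, continuous function of (x, t, t') in X * [-M, M]^2. *)
Definition cube_continuous (g : X * R * R -> \bar R) : Prop :=
  (forall z, param_cube z -> g z \is a fin_num) /\
  {within param_cube, continuous (fun z => fine (g z))}.

Definition assumptionD : Prop :=
  [/\ cube_continuous (fun z => Ex z.1.1 (llratio (f z.1.2) (f z.2))),
      forall a : R, 0 <= a <= 1 ->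
        cube_continuous
          (fun z => Ex z.1.1 (fun y => (lratio (f z.1.2) (f z.2) y `^ a)%E))
    & exists C : R, forall z, param_cube z ->
        (Ex z.1.1 (fun y => llratio (f z.1.2) (f z.2) y ^+ 2) <= C%:E)%E].

Definition assumptionE (thstar : X -> R) : Prop :=
  forall e : R, 0 < e -> exists2 del : R, 0 < del < 1 &
    forall (x : X) (t : R), t \in `[- M, M] ->
      (Ex x (llratio (f (thstar x)) (f t)) < del%:E)%E ->
      `|t - thstar x| < e.

(* Covariates and responses are indexed from 0, so the first n observations
   are those with index i < n. *)
Definition likelihood (thstar : X -> R) (xs : nat -> X) (y : nat -> S)
    (n : nat) (th : X -> R) : \bar R :=
  (\prod_(i < n) lratio (f (th (xs i))) (f (thstar (xs i))) (y i))%E.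

Definition posterior (Theta : set (paramType X))
    (Pi : probability (paramType X) R) (thstar : X -> R) (xs : nat -> X)
    (y : nat -> S) (n : nat) (A : set (paramType X)) : \bar R :=
  ((\int[Pi]_(th in A) likelihood thstar xs y n th) /
   (\int[Pi]_(th in Theta) likelihood thstar xs y n th))%E.

(* The Y_i are independent with Y_i ~ f_{0 x_i}, on some probability space
   (Omega, P0); for Omega the sequence space and Y its coordinates, P0 is the
   infinite product measure. *)
Definition independent_responses (d' : measure_display)
    (Omega : measurableType d') (P0 : probability Omega R)
    (xs : nat -> X) (Y : nat -> Omega -> S) : Prop :=
  [/\ forall i, measurable_fun setT (Y i),
      forall i (B : set S), measurable B ->
        P0 (Y i @^-1` B) = (\int[mu]_(y in B) (f0 (xs i) y)%:E)%E
    & forall (J : {fset nat}) (B : nat -> set S),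
        (forall i, measurable (B i)) ->
        P0 (\bigcap_(i in [set` J]) (Y i @^-1` B i)) =
        (\prod_(i <- J) P0 (Y i @^-1` B i))%E].

End model.

(* Main.v *)
Require Import Defs.
From mathcomp Require Import measurable_realfun.
From mathcomp Require Import ring lra.

(* Write L_n for the likelihood ratio against thstar.  All almost sure
   bounds come from exponential moments and the Borel-Cantelli lemma.

   Denominator: E_x [f_t / f_t'] is continuous in (x, t, t') and equals 1 for
   t = t', so by compactness it is at most exp eta once |t - t'| is small,
   uniformly in x.  Hence the integral of 1 / L_n over a small ball around
   thstar has expectation at most exp (n eta), and since 2c <= 1/L + c^2 L the
   evidence is almost surely at least a constant times exp (- n beta), for any
   beta > 0.

   Numerator: if th0 differs from thstar by more than e at some x0, then
   E_x [log (f_th0 / f_thstar)] <= - del for x near x0 and is nonpositive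
   everywhere (assumption E), while the design visits the neighborhood of x0
   with positive frequency (assumption B).  A second order expansion in a of
   E_x [(f_th0 / f_thstar)^a] makes L_n(th0) exponentially small.  Over a small
   ball around th0 the mixture of the ratios f_th / f_th0 again has
   expectation at most exp (n eta), so the ball contributes an exponentially
   small amount to the numerator.  Finitely many such balls cover Theta. *)

Set Implicit Arguments.
Unset Strict Implicit.
Unset Printing Implicit Defensive.

Local Open Scope classical_set_scope.
Local Open Scope ring_scope.

(** * Measurability and integration *)

Section measurability.
Context (R : realType) (d : measure_display) (T : measurableType d).

Lemma measurable_lne : measurable_fun [set: \bar R] (@lne R).
Proof.
rewrite (_ : @lne R = fun x => if (x <= 0)%E then -oo%E
    else if x == +oo%E then +oo%E else (ln (fine x))%:E); last first.
  apply/funext => -[r| |] //=; rewrite ?lee_fin ?leeNy_eq ?leNye //.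
apply: measurable_fun_ifT => //; first exact: measurable_fun_lee.
apply: measurable_fun_ifT => //; first exact: measurable_fun_eqe.
apply/measurable_EFinP; apply: measurableT_comp => //; exact: measurable_ln.
Qed.

Lemma measurable_lratio (p q : T -> R) :
  measurable_fun setT p -> measurable_fun setT q ->
  (forall y, 0 <= q y) -> measurable_fun setT (lratio p q).
Proof.
move=> mp mq q0.
rewrite (_ : lratio p q = fun y => ((p y)%:E *
    (if (q y == 0)%R then +oo else (q y `^ (-1))%:E))%E); last first.
  apply/funext => y; rewrite /lratio inver.
  by case: ifPn => // _; rewrite powR_inv1.
apply: emeasurable_funM; first exact/measurable_EFinP.
apply: measurable_fun_ifT => //; first exact: measurable_fun_eqr.
apply/measurable_EFinP; exact: (measurableT_comp (measurable_powR (-1)) mq).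
Qed.

Lemma measurable_llratio (p q : T -> R) :
  measurable_fun setT p -> measurable_fun setT q ->
  (forall y, 0 <= q y) -> measurable_fun setT (llratio p q).
Proof.
move=> mp mq q0.
exact: (measurableT_comp measurable_lne (measurable_lratio mp mq q0)).
Qed.

Lemma measurable_prode (n : nat) (g : nat -> T -> \bar R) :
  (forall i, measurable_fun setT (g i)) ->
  measurable_fun setT (fun y => \prod_(i < n) g i y)%E.
Proof.
move=> mg; elim: n => [|n IH].
  rewrite (_ : (fun _ => _) = cst 1%E) //.
  by apply/funext => y; rewrite big_ord0.
rewrite (_ : (fun _ => _) = fun y => (\prod_(i < n) g i y * g n y)%E); last first.
  by apply/funext => y; rewrite big_ord_recr.
exact: emeasurable_funM.
Qed.

End measurability.

Lemma lratio_ge0 (R : realType) (d : measure_display) (T : measurableType d)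
    (p q : T -> R) y : 0 <= p y -> 0 <= q y ->
  (0 <= lratio p q y)%E.
Proof.
by move=> p0 q0; rewrite mule_ge0 ?lee_fin// inver; case: ifP => // _; rewrite lee_fin invr_ge0.
Qed.

(** * Equality of integrals, from indicators to nonnegative functions *)

Section transfer.
Import HBNNSimple.
Context (R : realType).

(** The product rule for limits is problematic only at [0 * +oo]. If [l = 0], monotonicity makes
    every term zero; if [w = 0], both sides vanish because [+oo * 0 = 0]. *)
Lemma nd_cvgeMr (h : nat -> R) (l w : \bar R) :
  nondecreasing_seq h -> (forall n, 0 <= h n) -> (h n)%:E @[n --> \oo] --> l ->
  (0 <= w)%E -> ((h n)%:E * w)%E @[n --> \oo] --> (l * w)%E.
Proof.
move=> ndh h0 hl w0.
have hle n : ((h n)%:E <= l)%E.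
  rewrite -(cvg_lim _ hl)//; apply: lime_ge; first by apply/cvg_ex; exists l.
  by near=> k; rewrite lee_fin; apply: ndh; near: k; exact: nbhs_infty_ge.
have [l0|l0] := eqVneq l 0%E.
  rewrite (_ : (fun _ => _) = cst (l * w)%E); first exact: cvg_cst.
  apply/funext => n /=; rewrite l0; congr (_ * _)%E.
  by apply/eqP; rewrite eq_le; apply/andP; split; [rewrite -l0|rewrite lee_fin].
have [->|wN0] := eqVneq w 0%E.
  by under eq_fun do rewrite mule0; rewrite mule0; exact: cvg_cst.
apply: cvgeM => //; last exact: cvg_cst.
by apply: neq0_mule_def; rewrite mule_neq0.
Unshelve. all: by end_near. Qed.

Lemma integral_nnsfun_weight (d d' : measure_display) (T : measurableType d)
    (S : measurableType d') (m : {measure set T -> \bar R}) (p : T -> S)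
    (w : T -> \bar R) (h : {nnsfun S >-> R}) :
  measurable_fun setT p -> measurable_fun setT w -> (forall x, 0 <= w x)%E ->
  (\int[m]_x ((h (p x))%:E * w x) =
   \sum_(k \in range h) k%:E * \int[m]_x ((\1_(h @^-1` [set k]) (p x))%:E * w x))%E.
Proof.
move=> mp mw w0.
have mI k : measurable_fun setT (fun x => ((\1_(h @^-1` [set k]) (p x))%:E * w x)%E).
  apply: emeasurable_funM => //; apply/measurable_EFinP.
  by apply: (measurableT_comp _ mp).
under eq_integral => x _.
  rewrite fimfunE -fsumEFin// ge0_mule_fsuml; last first.
    by move=> k; rewrite EFinM; exact: nnfun_muleindic_ge0.
  over.
rewrite ge0_integral_fsum//.
- apply: eq_fsbigr => k; rewrite inE => -[y _ <-].
  under eq_integral do rewrite EFinM -muleA.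
  rewrite ge0_integralZl// ?lee_fin//.
  by move=> x _; rewrite mule_ge0// lee_fin.
- move=> k; under eq_fun do rewrite EFinM -muleA.
  exact: measurable_funeM.
- by move=> k x _; rewrite mule_ge0// EFinM nnfun_muleindic_ge0.
Qed.

(** Linearity passes from indicators to simple functions, monotone convergence from these to
    nonnegative measurable ones. With both a map and a weight on each side, it serves for the law of
    a response (the weight is a density) and for splitting one factor off a product (the weight is
    the product of the others). *)
Lemma ge0_integral_transfer (d1 d2 d' : measure_display)
    (T1 : measurableType d1) (T2 : measurableType d2) (S : measurableType d')
    (m1 : {measure set T1 -> \bar R}) (m2 : {measure set T2 -> \bar R})
    (p1 : T1 -> S) (p2 : T2 -> S) (w1 : T1 -> \bar R) (w2 : T2 -> \bar R) :
  measurable_fun setT p1 -> measurable_fun setT p2 ->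
  measurable_fun setT w1 -> measurable_fun setT w2 ->
  (forall x, 0 <= w1 x)%E -> (forall x, 0 <= w2 x)%E ->
  (forall B, measurable B ->
    \int[m1]_x ((\1_B (p1 x))%:E * w1 x) =
    \int[m2]_x ((\1_B (p2 x))%:E * w2 x))%E ->
  forall g : S -> \bar R, measurable_fun setT g -> (forall y, 0 <= g y)%E ->
  (\int[m1]_x (g (p1 x) * w1 x) = \int[m2]_x (g (p2 x) * w2 x))%E.
Proof.
move=> mp1 mp2 mw1 mw2 w10 w20 E g mg g0.
pose h := nnsfun_approx measurableT mg.
have aux d (T : measurableType d) (m : {measure set T -> \bar R}) (p : T -> S)
    (w : T -> \bar R) : measurable_fun setT p -> measurable_fun setT w ->
    (forall x, 0 <= w x)%E ->
    (\int[m]_x (g (p x) * w x) =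
     limn (fun n => \int[m]_x ((h n (p x))%:E * w x)))%E.
  move=> mp mw w0.
  rewrite -monotone_convergence//.
  - apply: eq_integral => x _; apply/esym/cvg_lim => //.
    apply: (@nd_cvgeMr (fun n => h n (p x))) => //.
    + by move=> a b ab; exact/lefP/nd_nnsfun_approx.
    + exact: (cvg_nnsfun_approx measurableT mg).
  - move=> n; apply: emeasurable_funM => //; apply/measurable_EFinP.
    exact: (measurableT_comp _ mp).
  - by move=> n x _; rewrite mule_ge0// lee_fin.
  - move=> x _ a b ab; rewrite lee_wpmul2r// lee_fin; exact/lefP/nd_nnsfun_approx.
rewrite (aux _ _ m1 p1 w1)// (aux _ _ m2 p2 w2)//; congr (limn _).
apply/funext => n; rewrite integral_nnsfun_weight// integral_nnsfun_weight//.
by apply: eq_fsbigr => k _; rewrite E.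
Qed.

End transfer.

(** The removed factor is replaced by [1], so the remaining product still ranges over all [i < n]
    and [measurable_prode] applies to it. *)
Lemma prode_bigD1 (R : realType) (n k : nat) (a : nat -> \bar R) : (k < n)%N ->
  (\prod_(i < n) a i = a k * \prod_(i < n) (if i == k :> nat then 1 else a i))%E.
Proof.
move=> kn; rewrite (bigD1 (Ordinal kn))//= [in RHS](bigD1 (Ordinal kn))//= eqxx mul1e.
congr (_ * _)%E; apply: eq_bigr => i ik.
by rewrite ifN//; apply: contra ik => /eqP ik; apply/eqP/val_inj.
Qed.

Lemma prode_indic (R : realType) (T : Type) (n : nat) (B : nat -> set T) x :
  (\prod_(i < n) (\1_(B i) x)%:E = (\1_(\bigcap_(i in `I_n) B i) x)%:E :> \bar R)%E.
Proof.
rewrite prodEFin; congr (_%:E); rewrite indicE.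
have [xB|xB] := pselect ((\bigcap_(i in `I_n) B i) x).
  rewrite mem_set//.
  by apply: big1 => i _; rewrite indicE mem_set//; exact: (xB i (ltn_ord i)).
rewrite memNset//; have [i [iN xBi]] : exists i, (i < n)%N /\ ~ B i x.
  apply: contrapT => /forallNP H; apply: xB => i /= iN.
  by apply: contrapT => nB; exact: (H i (conj iN nB)).
by rewrite (bigD1 (Ordinal iN))//= indicE memNset// mul0r.
Qed.

(** * Independence and expectations of products *)

Section independence.
Context (R : realType) (d d' : measure_display) (S : measurableType d)
  (Omega : measurableType d') (P0 : probability Omega R) (Y : nat -> Omega -> S).
Hypothesis mY : forall i, measurable_fun setT (Y i).
Hypothesis indep : forall (J : {fset nat}) (B : nat -> set S),
  (forall i, measurable (B i)) ->
  P0 (\bigcap_(i in [set` J]) (Y i @^-1` B i)) =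
  (\prod_(i <- J) P0 (Y i @^-1` B i))%E.

(** A product of indicators is the indicator of an intersection, to which [indep] applies with the
    indices below [n] as [J]. *)
Lemma integral_prod_indic_indep n (B : nat -> set S) : (forall i, measurable (B i)) ->
  (\int[P0]_w \prod_(i < n) (\1_(B i) (Y i w))%:E =
   \prod_(i < n) \int[P0]_w (\1_(B i) (Y i w))%:E)%E.
Proof.
move=> mB.
have mYB i : measurable (Y i @^-1` B i) by rewrite -[X in measurable X]setTI; exact: mY.
under eq_integral do rewrite (prode_indic R n (fun i => Y i @^-1` B i)).
rewrite integral_indic// ?setIT; last first.
  by apply: bigcap_measurableType => i _; exact: mYB.
have -> : `I_n = [set` [fset i | i in iota 0 n]%fset].
  by apply/seteqP; split => i /=; rewrite !inE mem_iota.
etransitivity; first exact: (indep _ mB).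
rewrite (perm_big (iota 0 n)) /=; last first.
  by apply: uniq_perm; [exact: fset_uniq|exact: iota_uniq|move=> i; rewrite !inE].
rewrite -{1}(subn0 n) -/(index_iota 0 n) big_mkord; apply: eq_bigr => i _.
by rewrite (_ : (fun w => _) = fun w => (\1_(Y i @^-1` B i) w)%:E)//
  integral_indic// setIT.
Qed.

Lemma integral_prod_indep n (g : nat -> S -> \bar R) :
  (forall i, measurable_fun setT (g i)) -> (forall i y, 0 <= g i y)%E ->
  (\int[P0]_w \prod_(i < n) g i (Y i w) = \prod_(i < n) \int[P0]_w g i (Y i w))%E.
Proof.
(* Induction on the number [k] of factors that are not indicators: the product
   formula for an indicator as [k]-th factor transfers to a general one. *)
suff H k : forall g : nat -> S -> \bar R,
    (forall i, measurable_fun setT (g i)) -> (forall i y, 0 <= g i y)%E ->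
    (forall i, (k <= i)%N -> exists2 B, measurable B & g i = fun y => (\1_B y)%:E) ->
    (\int[P0]_w \prod_(i < n) g i (Y i w) = \prod_(i < n) \int[P0]_w g i (Y i w))%E.
  (* Factors with index at least [n] do not enter the product. Replacing them by the indicator of
     the whole space allows the case [k = n]. *)
  move=> mg g0; pose h i := if (i < n)%N then g i else fun y => (\1_(@setT S) y)%:E.
  have hE (i : 'I_n) : h i = g i by rewrite /h ltn_ord.
  under eq_integral do under eq_bigr do rewrite -hE.
  under [RHS]eq_bigr do rewrite -hE.
  apply: (H n).
  - by move=> i; rewrite /h; case: ifP => // _; exact/measurable_EFinP.
  - by move=> i y; rewrite /h; case: ifP.
  - by move=> i ni; exists setT => //; rewrite /h ltnNge ni.
elim: k => [|k IH] {}g mg g0 gI.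
  have [B BE] : {B : nat -> set S & forall i, measurable (B i) /\
      g i = fun y => (\1_(B i) y)%:E}.
    apply: (@choice _ _ (fun i B => measurable B /\ g i = fun y : S => (\1_B y)%:E)) => i.
    by have [//|B] := gI i; exists B.
  under eq_integral do under eq_bigr do rewrite (BE _).2.
  under [RHS]eq_bigr do rewrite (BE _).2.
  by apply: integral_prod_indic_indep => i; exact: (BE i).1.
pose h B i := if i == k then fun y => (\1_B y)%:E else g i.
have hE B : measurable B ->
    (\int[P0]_w \prod_(i < n) h B i (Y i w) = \prod_(i < n) \int[P0]_w h B i (Y i w))%E.
  move=> mB; apply: IH.
  - by move=> i; rewrite /h; case: ifP => // _; exact/measurable_EFinP.
  - by move=> i y; rewrite /h; case: ifP => // _; rewrite lee_fin.
  - move=> i ki; rewrite /h; case: ifPn => ik; first by exists B.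
    by apply: gI; rewrite ltn_neqAle ki eq_sym ik.
(* If [n <= k], the [k]-th factor does not occur and may be replaced by an indicator at will. *)
have [nk|kn] := leqP n k.
  have {}hE0 := hE setT measurableT.
  have hg (i : 'I_n) : h setT i = g i.
    by rewrite /h ifN// neq_ltn (leq_trans (ltn_ord i) nk).
  transitivity (\prod_(i < n) \int[P0]_w h setT i (Y i w))%E.
    by rewrite -hE0; apply: eq_integral => w _; apply: eq_bigr => i _; rewrite hg.
  by apply: eq_bigr => i _; rewrite hg.
pose w1 w := (\prod_(i < n) (if i == k :> nat then 1 else g i (Y i w)))%E.
pose c := (\prod_(i < n) (if i == k :> nat then 1 else \int[P0]_w g i (Y i w)))%E.
have mg' i : measurable_fun setT (fun w => if i == k then 1%E else g i (Y i w)).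
  by case: (i == k) => //; exact: measurableT_comp.
have mw1 : measurable_fun setT w1 by exact: (measurable_prode n mg').
have w10 w : (0 <= w1 w)%E by apply: prode_ge0 => i _; case: ifP.
have c0 : (0 <= c)%E.
  by apply: prode_ge0 => i _; case: ifP => // _; exact: integral_ge0.
rewrite (prode_bigD1 (fun i => \int[P0]_w g i (Y i w))%E kn) -/c.
under eq_integral do rewrite (prode_bigD1 (fun i => g i (Y i _)) kn).
rewrite -/w1 -ge0_integralZr//; last exact: measurableT_comp.
apply: (@ge0_integral_transfer _ _ _ _ _ _ _ P0 P0 (Y k) (Y k) w1 (cst c)) => //.
move=> B mB; transitivity (\int[P0]_w \prod_(i < n) h B i (Y i w))%E.
  apply: eq_integral => w _; rewrite [RHS](prode_bigD1 (fun i => h B i (Y i w)) kn).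
  by rewrite /h eqxx; congr (_ * _)%E; apply: eq_bigr => i _; case: ifP.
rewrite hE//.
rewrite (prode_bigD1 (fun i => \int[P0]_w h B i (Y i w))%E kn).
have -> : (\prod_(i < n) (if i == k :> nat then 1 else \int[P0]_w h B i (Y i w)) = c)%E.
  by apply: eq_bigr => i _; rewrite /h; case: (nat_of_ord i == k).
rewrite /h eqxx -ge0_integralZr//.
  by apply/measurable_EFinP; apply: (@measurableT_comp _ _ _ _ _ _ (\1_B : S -> R)).
Qed.

End independence.

(** Markov's inequality bounds the probability that [Z n] reaches [expR (n * b')] by
    [expR (n * (b - b'))]. This is a convergent geometric series, so Borel-Cantelli applies. *)
Lemma ae_exp_bound (R : realType) (d : measure_display) (Omega : measurableType d)
    (P0 : probability Omega R) (Z : nat -> Omega -> \bar R) (b b' : R) : b < b' ->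
  (forall n, measurable_fun setT (Z n)) -> (forall n w, 0 <= Z n w)%E ->
  (\forall n \near \oo, \int[P0]_w Z n w <= (expR (n%:R * b))%:E)%E ->
  {ae P0, forall w, \forall n \near \oo, (Z n w <= (expR (n%:R * b'))%:E)%E}.
Proof.
move=> bb' mZ Z0 [N _ ZN].
(* The shift by [N] makes the moment bound available at every index. Dropping the factor
   [q ^+ N <= 1] leaves the geometric bound of [PF]. *)
pose F n := [set w | ((expR ((N + n)%:R * b'))%:E <= Z (N + n)%N w)%E].
have mF n : measurable (F n).
  by rewrite -[F n]setTI; apply: emeasurable_fun_c_infty.
pose q : R := expR (b - b').
have q0 : 0 < q by exact: expR_gt0.
have q1 : `|q| < 1 by rewrite gtr0_norm// expR_lt1 subr_lt0.
have PF n : (P0 (F n) <= (geometric 1 q n)%:E)%E.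
  have := le_integral_abse P0 measurableT (mZ (N + n)%N) (expR_gt0 ((N + n)%:R * b')).
  rewrite setTI (_ : [set _ | _] = F n); last first.
    by apply/seteqP; split => w /=; rewrite gee0_abs.
  under eq_integral do rewrite gee0_abs//.
  move=> /le_trans/(_ (ZN (N + n)%N (leq_addr _ _))).
  rewrite -lee_pdivlMl ?expR_gt0// -EFinM -expRN -expRD => /le_trans; apply.
  rewrite lee_fin /= mul1r -expRM_natl ler_expR addrC -mulrBr.
  by apply: ler_wnM2r; [rewrite subr_le0 ltW|rewrite ler_nat leq_addl].
exists (lim_sup_set F); split.
- by apply: bigcapT_measurable => n; apply: bigcup_measurable => k _.
- apply: lim_sup_set_cvg0 => //.
  apply: (@le_lt_trans _ _ (1 * (1 - q)^-1)%:E); last exact: ltry.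
  apply: lime_le; first by apply: is_cvg_nneseries.
  apply: nearW => n; apply: (@le_trans _ _ (series (geometric 1 q) n)%:E).
    by rewrite /series /= -sumEFin lee_sum// => i _; exact: PF.
  by rewrite lee_fin geometric_le_lim.
- move=> w /= nw n _; apply: contrapT => nF; apply: nw.
  exists (N + n)%N => // m /= nm.
  have Nm : (m = N + (m - N))%N by rewrite subnKC// (leq_trans _ nm)// leq_addr.
  rewrite leNgt; apply/negP => Zm; apply: nF; exists (m - N)%N => /=.
    by rewrite leq_subRL// (leq_trans _ nm)// leq_addr.
  by rewrite /F /= -Nm ltW.
Qed.

(** * The parameter space *)

Section parameter_space.
Context (R : realType) (V : normedModType R) (X : set V).

(** The strict bound is pointwise, so the supremum may equal [r] and the set need not be open;
    interiors are taken where open sets are required. *)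
Definition unif_ball (th0 : X -> R) (r : R) : set (X -> R) :=
  [set th | forall x, `|th x - th0 x| < r].

Lemma nbhs_unif_ball (th0 : {uniform X -> R}) r : 0 < r ->
  nbhs th0 (unif_ball th0 r : set {uniform X -> R}).
Proof.
move=> r0; apply/uniform_nbhs; exists [set xy : R * R | ball xy.1 r xy.2]; split.
  by rewrite -entourage_from_ballE; exists r.
by move=> th /= H x; have := H x Logic.I; rewrite /= -ball_normE /= distrC.
Qed.

Lemma open_paramType (A : set {uniform X -> R}) : open A -> measurable (A : set (paramType X)).
Proof. by move=> oA; exact: sub_sigma_algebra. Qed.

Lemma continuous_eval_param (x : X) : continuous (fun th : {uniform X -> R} => th x).
Proof.
move=> th A /= /nbhs_ballP [r /= r0 rA].
apply: filterS (nbhs_unif_ball th r0) => th' /(_ x) h; apply: rA.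
by rewrite -ball_normE /= distrC.
Qed.

Lemma measurable_eval_param (x : X) : measurable_fun setT (fun th : paramType X => th x).
Proof.
apply: (measurability _ (RGenOpens.measurableE R)) => _ [_ [a [b ->] <-]].
rewrite setTI; apply: open_paramType.
apply: open_comp; last exact: interval_open.
by move=> th _; exact: continuous_eval_param.
Qed.

Lemma hausdorff_param : hausdorff_space {uniform X -> R}.
Proof.
move=> p q; rewrite -closeEnbhs hausdorrf_close_eq_in; last exact: Rhausdorff.
by move=> pq; apply/funext => x; apply: pq; rewrite inE.
Qed.

Lemma compact_measurable_param (A : set {uniform X -> R}) :
  compact A -> measurable (A : set (paramType X)).
Proof.
move=> /(compact_closed hausdorff_param)/closed_openC/open_paramType mA.
by rewrite -(setCK A); exact: measurableC.
Qed.

(** A filter on the type [X] is pushed forward to [V]. The image contains the set [X], hence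
    clusters at one of its points; since open sets of the type are traces of open sets of [V], the
    original filter clusters there too. *)
Lemma compact_setT_subtype : compact X -> compact [set: X].
Proof.
move=> cX F PF _.
have PG : ProperFilter (set_val @ F : set_system V) by exact: fmap_proper_filter.
have GX : (set_val @ F : set_system V) X.
  rewrite /nbhs /= /fmap /=; apply: filterS filterT => x _ /=; exact: set_valP.
have [p [Xp clp]] := cX _ PG GX.
exists (SigSub (mem_set Xp)); split => // A B FA [_ [[W oW <-] /= Wp] WB].
have [] := clp (set_val @` A) W.
- by rewrite /nbhs /= /fmap /=; apply: filterS FA => x Ax; exists x.
- exact: open_nbhs_nbhs.
- by move=> _ [[x Ax <-] Wx]; exists x; split => //; apply: WB.
Qed.

End parameter_space.

Section supdist.
Context (R : realType) (V : normedModType R) (X : set V) (M : R).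
Variables (th1 th2 : X -> R).
Hypotheses (th1M : forall x, th1 x \in `[- M, M]) (th2M : forall x, th2 x \in `[- M, M]).

Lemma supdist_ge x : `|th1 x - th2 x| <= supdist th1 th2.
Proof.
apply: ub_le_sup; last by exists x.
exists (2 * M) => _ [z _ <-].
by move: (th1M z) (th2M z); rewrite !in_itv /= ler_norml => /andP[? ?] /andP[? ?]; lra.
Qed.

Lemma supdist_le (x0 : X) r : (forall x, `|th1 x - th2 x| <= r) -> supdist th1 th2 <= r.
Proof.
move=> H; apply: ge_sup; first by exists `|th1 x0 - th2 x0|, x0.
by move=> _ [x _ <-].
Qed.

Lemma supdist_gtP (x0 : X) r : r < supdist th1 th2 <-> exists x, r < `|th1 x - th2 x|.
Proof.
split=> [H|[x Hx]]; last exact: lt_le_trans (supdist_ge x).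
apply: contrapT => /forallNP nH; move: H; apply/negP; rewrite -leNgt.
by apply: supdist_le => // x; rewrite leNgt; apply/negP/nH.
Qed.

End supdist.

Section measurable_supdist.
Context (R : realType) (V : normedModType R) (X : set V) (M : R).
Variables (Theta : set (paramType X)) (thstar : X -> R) (x0 : X).
Hypothesis mTheta : measurable Theta.
Hypothesis ThetaM : forall th : X -> R, Theta th -> forall x, th x \in `[- M, M].
Hypothesis Tthstar : Theta thstar.

(** The supremum exceeds [r] as soon as one point does. The union over [X] may be uncountable, but
    its members are open, so it is open and hence Borel. *)
Lemma measurable_supdist_gt r :
  measurable [set th : paramType X | Theta th /\ supdist th thstar > r].
Proof.
rewrite (_ : [set _ | _] = Theta `&`
    \bigcup_x ((fun th : {uniform X -> R} => th x) @^-1` [set t | r < `|t - thstar x|])).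
  apply: measurableI => //; apply: open_paramType; apply: bigcup_open => x _.
  apply: open_comp; first by move=> th _; exact: continuous_eval_param.
  apply: (@open_comp _ _ (fun t : R => `|t - thstar x|) [set u | r < u]).
    by move=> t _; apply: cvg_norm; apply: cvgB; [exact: cvg_id|exact: cvg_cst].
  exact: open_gt.
apply/seteqP; split => th /= [Tth].
  move/(supdist_gtP (ThetaM Tth) (ThetaM Tthstar) x0) => [x rx]; split => //; by exists x.
move=> [x _ /= rx]; split => //.
by apply/(supdist_gtP (ThetaM Tth) (ThetaM Tthstar) x0); exists x.
Qed.

(** The set is the trace on [Theta] of a union of interiors of uniform balls. Half of the slack
    [r - supdist th thstar] as radius keeps the inequality strict after passing to the supremum. *)
Lemma measurable_supdist_lt r :
  measurable [set th : paramType X | Theta th /\ supdist th thstar < r].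
Proof.
set W := [set _ | _].
rewrite (_ : W = Theta `&` \bigcup_(th in W)
   (unif_ball th ((r - supdist th thstar) / 2) : set {uniform X -> R})°).
  apply: measurableI => //; apply: open_paramType; apply: bigcup_open => th _.
  exact: open_interior.
apply/seteqP; split => th /= [Tth].
  move=> rth; split => //; exists th => //; apply: nbhs_unif_ball.
  by rewrite divr_gt0// subr_gt0.
move=> [th' [Tth' rth'] /interior_subset H]; split => //.
apply: (@le_lt_trans _ _ ((r + supdist th' thstar) / 2)); last by lra.
apply: supdist_le => // x.
have := supdist_ge (ThetaM Tth') (ThetaM Tthstar) x.
have := H x; have := ler_distD (th' x) (th x) (thstar x); lra.
Qed.

End measurable_supdist.

(** * Likelihood ratios *)

(** Everything rests on [expR v * (1 - v) <= 1]. For [v >= 0] it gives [expR v <= 1 + v * expR v],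
    and, multiplied by [v], it bounds the last term by [v + v ^+ 2 * expR v]. For [v < 0] already
    [1 + v + v ^+ 2] is enough, since its product with [1 - v] is [1 - v ^+ 3 >= 1]. *)
Lemma expR_le_quad (R : realType) (v : R) : expR v <= 1 + v + v ^+ 2 * (1 + expR v).
Proof.
have v1 : 1 - v <= (expR v)^-1 by rewrite -expRN; exact: expR_ge1Dx.
have v2 := expR_gt0 v.
have v3 : expR v * (1 - v) <= 1 by rewrite mulrC -ler_pdivlMr// mul1r.
have [v0|v0] := leP 0 v.
  have : v * (expR v * (1 - v)) <= v * 1 by rewrite ler_wpM2l.
  nra.
apply: (@le_trans _ _ (1 + v + v ^+ 2)); last by have := sqr_ge0 v; nra.
have v4 : 0 < 1 - v by lra.
rewrite -(ler_pM2r v4); apply: le_trans v3 _.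
have -> : (1 + v + v ^+ 2) * (1 - v) = 1 - v * v ^+ 2 by ring.
have := sqr_ge0 v; nra.
Qed.

(** For a log-likelihood ratio [u], the remainder is expressed through [u ^+ 2] and the ratio
    [expR u], whose expectations are controlled. For [u > 0], [a <= 1/2] gives
    [expR (a * u) <= expR (u / 2)], and squaring [1 + u / 4 <= expR (u / 4)] gives
    [u ^+ 2 <= 16 * expR (u / 2)]; the two halves multiply to [expR u]. *)
Lemma expR_scale_le (R : realType) (a u : R) : 0 < a -> a <= 2^-1 ->
  expR (a * u) <= 1 + a * u + a ^+ 2 * (2 * u ^+ 2 + 16 * expR u).
Proof.
move=> a0 a2; apply: le_trans (expR_le_quad _) _.
rewrite lerD2l exprMn -mulrA ler_wpM2l ?sqr_ge0//.
have [u0|u0] := leP u 0.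
  have : expR (a * u) <= 1 by rewrite expR_le1 pmulr_rle0.
  have := expR_gt0 u; have := sqr_ge0 u; nra.
have w1 : 1 + u / 4 <= expR (u / 4) by exact: expR_ge1Dx.
have w2 : expR (u / 2) = expR (u / 4) ^+ 2.
  by rewrite expr2 -expRD; congr expR; lra.
have w3 : expR u = expR (u / 2) ^+ 2.
  by rewrite expr2 -expRD; congr expR; lra.
have w4 : expR (a * u) <= expR (u / 2) by rewrite ler_expR mulrC ler_pM2l.
have w5 : u ^+ 2 <= 16 * expR (u / 2) by rewrite w2; nra.
have w6 : 0 < expR (u / 2) by exact: expR_gt0.
have w7 : u ^+ 2 * expR (a * u) <= u ^+ 2 * expR (u / 2).
  by rewrite ler_wpM2l ?sqr_ge0.
have w8 : u ^+ 2 * expR (u / 2) <= 16 * expR (u / 2) * expR (u / 2).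
  by rewrite ler_wpM2r// ltW.
rewrite w3; have := sqr_ge0 u; nra.
Qed.

Section ratio.
Context (R : realType) (d : measure_display) (S : measurableType d)
  (mu : {measure set S -> \bar R}) (w p q : S -> R).
Hypotheses (mw : measurable_fun setT w) (w0 : forall y, 0 <= w y)
  (w1 : (\int[mu]_y (w y)%:E = 1)%E).
Hypotheses (mp : measurable_fun setT p) (p0 : forall y, 0 <= p y).
Hypotheses (mq : measurable_fun setT q) (q0 : forall y, 0 <= q y).

Definition support_ae (p : S -> R) := {ae mu, forall y, 0 < w y -> 0 < p y}.

(* [llratio p p = -oo] where [p = 0], because [0 / 0 = 0] and [lne 0 = -oo]. *)
Lemma support_ae_llratio :
  (\int[mu]_y (llratio p p y * (w y)%:E) \is a fin_num)%E -> support_ae p.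
Proof.
have mpp : measurable_fun setT (fun y => llratio p p y * (w y)%:E)%E.
  by apply: emeasurable_funM; [exact: measurable_llratio|exact/measurable_EFinP].
move=> fin; have /integrable_ae : mu.-integrable setT (fun y => llratio p p y * (w y)%:E)%E.
  apply/integrableP; split => //; apply/(abse_integralP _ measurableT mpp).
  by rewrite -fin_num_abs.
move=> /(_ measurableT); apply: filterS => y /(_ Logic.I) + wy.
rewrite lt_def p0 andbT; apply: contraTN => /eqP py.
by rewrite /llratio /lratio py mul0e le0_lneNy// gt0_mulNye ?lte_fin.
Qed.

Hypotheses (sp : support_ae p) (sq : support_ae q).

(** Where [w] vanishes both integrands are zero, even if [phi] is infinite. Elsewhere the ratio is
    almost everywhere a positive real, and there [phi] and [phir] agree. *)
Lemma integral_lratio_real (phi : \bar R -> \bar R) (phir : R -> R) :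
  measurable_fun setT phi -> measurable_fun setT phir ->
  (forall r, 0 < r -> phi r%:E = (phir r)%:E) ->
  (\int[mu]_y (phi (lratio p q y) * (w y)%:E) =
   \int[mu]_y (phir (fine (lratio p q y)) * w y)%:E)%E.
Proof.
move=> mphi mphir H; have mr := measurable_lratio mp mq q0.
apply: ae_eq_integral => //.
- apply: emeasurable_funM; [exact: measurableT_comp|exact/measurable_EFinP].
- apply/measurable_EFinP; apply: measurable_funM => //.
  by apply: measurableT_comp => //; exact: measurableT_comp.
- move: sp sq; apply: filterS2 => y py qy _.
  have [->|wy] := eqVneq (w y) 0; first by rewrite mulr0 mule0.
  have {}wy : 0 < w y by rewrite lt_def wy w0.
  rewrite {1}/lratio inver gt_eqF ?qy// -EFinM H ?divr_gt0 ?py ?qy//.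
  by rewrite /lratio inver gt_eqF ?qy.
Qed.

Lemma integral_llratioN : (\int[mu]_y (llratio p q y * (w y)%:E) \is a fin_num)%E ->
  (\int[mu]_y (llratio q p y * (w y)%:E) = - \int[mu]_y (llratio p q y * (w y)%:E))%E.
Proof.
move=> fin; rewrite -integralN; last first.
  by apply: fin_num_adde_defl; move: fin; rewrite integralE fin_numB fin_numN => /andP[].
  apply: ae_eq_integral => //.
  - by apply: emeasurable_funM; [exact: measurable_llratio|exact/measurable_EFinP].
  - apply: measurableT_comp => //.
    by apply: emeasurable_funM; [exact: measurable_llratio|exact/measurable_EFinP].
  - move: sp sq; apply: filterS2 => y py qy _.
    have [->|wy] := eqVneq (w y) 0; first by rewrite !mule0 oppe0.
    have {}wy : 0 < w y by rewrite lt_def wy w0.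
    rewrite -mulNe; congr (_ * _)%E.
    rewrite /llratio /lratio !inver !gt_eqF ?py ?qy// -!EFinM !lne_EFin ?divr_gt0 ?py ?qy//.
    by rewrite -EFinN -lnV ?posrE ?divr_gt0 ?py ?qy// invf_div.
Qed.

Lemma integral_lratio_diag :
  (\int[mu]_y (lratio p p y `^ 1 * (w y)%:E) = 1)%E.
Proof.
rewrite -w1; apply: ae_eq_integral => //.
- apply: emeasurable_funM; last exact/measurable_EFinP.
  apply: (measurableT_comp (measurable_poweR _)); exact: measurable_lratio.
- exact/measurable_EFinP.
- move: sp; apply: filterS => y py _.
  have [->|wy] := eqVneq (w y) 0; first by rewrite !mule0.
  have {}wy : 0 < w y by rewrite lt_def wy w0.
  by rewrite /lratio inver gt_eqF ?py// -EFinM divff ?gt_eqF ?py// powR1 mul1r.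
Qed.

(** This is [expR_scale_le] at the logarithm of the ratio, integrated against the density [w]. The
    bounds on the moments make each term of the right-hand side integrable. *)
Lemma integral_lratio_poweR_le (a : R) (L Q B : R) : 0 < a -> a <= 2^-1 ->
  (\int[mu]_y (lratio p q y `^ a * (w y)%:E) \is a fin_num)%E ->
  (\int[mu]_y (llratio p q y * (w y)%:E) = L%:E)%E ->
  (\int[mu]_y (llratio p q y ^+ 2 * (w y)%:E) <= Q%:E)%E ->
  (\int[mu]_y (lratio p q y * (w y)%:E) <= B%:E)%E ->
  (\int[mu]_y (lratio p q y `^ a * (w y)%:E) <=
    (1 + a * L + a ^+ 2 * (2 * Q + 16 * B))%:E)%E.
Proof.
move=> a0 a2.
have mr := measurable_lratio mp mq q0.
pose rho y := fine (lratio p q y).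
have mrho : measurable_fun setT rho by exact: measurableT_comp.
have rho0 y : 0 <= rho y by rewrite /rho fine_ge0// lratio_ge0.
rewrite (@integral_lratio_real (fun z => z `^ a)%E (fun r => r `^ a)
  (measurable_poweR a) (measurable_powR a) (fun r _ => erefl)).
rewrite (@integral_lratio_real (@lne R) (@ln R) (@measurable_lne R) (@measurable_ln R)
  (fun r r0 => lne_EFin r0)).
have mln2 : measurable_fun setT (fun r : R => ln r ^+ 2).
  exact: (measurable_funX 2 (@measurable_ln R)).
have mlne2 : measurable_fun setT (fun z : \bar R => lne z ^+ 2)%E.
  by apply: emeasurable_funM; exact: measurable_lne.
rewrite (@integral_lratio_real (fun z => lne z ^+ 2)%E (fun r => ln r ^+ 2))//; last first.
  by move=> r r0; rewrite lne_EFin.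
rewrite (@integral_lratio_real id id)//.
rewrite -/(rho _).
have mk (h : R -> R) : measurable_fun setT h -> measurable_fun setT (fun y => h (rho y) * w y).
  by move=> mh; apply: measurable_funM => //; exact: measurableT_comp.
have toint (h : S -> R) : measurable_fun setT h ->
    (\int[mu]_y (h y)%:E)%E \is a fin_num -> mu.-integrable setT (EFin \o h).
  move=> mh fin; apply/integrableP; split; first exact/measurable_EFinP.
  by rewrite integral_fin_num_abs.
move=> finA EL EQ EB.
have iA := toint _ (mk _ (measurable_powR a)) finA.
have iL : mu.-integrable setT (EFin \o (fun y => ln (rho y) * w y)).
  by apply: toint; [exact: (mk _ (@measurable_ln R))|rewrite EL].
have iQ : mu.-integrable setT (EFin \o (fun y => ln (rho y) ^+ 2 * w y)).
  apply: toint; [exact: (mk _ mln2)|rewrite ge0_fin_numE; first exact: le_lt_trans EQ (ltry _)].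
  by apply: integral_ge0 => y _; rewrite lee_fin mulr_ge0 ?sqr_ge0.
have iB : mu.-integrable setT (EFin \o (fun y => rho y * w y)).
  apply: toint; [exact: (mk id)|rewrite ge0_fin_numE; first exact: le_lt_trans EB (ltry _)].
  by apply: integral_ge0 => y _; rewrite lee_fin mulr_ge0.
have iw : mu.-integrable setT (EFin \o w) by apply: toint => //; rewrite w1.
have iL' := integrableZl measurableT a iL.
have iQ' := integrableZl measurableT (a ^+ 2 * 2) iQ.
have iB' := integrableZl measurableT (a ^+ 2 * 16) iB.
have i1 := integrableD measurableT iw iL'.
have i2 := integrableD measurableT iQ' iB'.
have i3 := integrableD measurableT i1 i2.
apply: le_trans (le_integral measurableT iA i3 _) _.
  move=> y _ /=; rewrite -!EFinM -!EFinD lee_fin.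
  rewrite [leRHS](_ : _ = (1 + a * ln (rho y) +
    a ^+ 2 * (2 * ln (rho y) ^+ 2 + 16 * rho y)) * w y); last by ring.
  rewrite ler_wpM2r//.
  (* At ratio zero the default [ln 0 = 0] and the vanishing of the power reduce the claim to
     [0 <= 1]. *)
  have [r0|r0] := eqVneq (rho y) 0.
    by rewrite r0 powR0 ?gt_eqF// ln0// !mulr0 expr0n /= !mulr0 !addr0 mulr0 addr0.
  have {}r0 : 0 < rho y by rewrite lt_def r0 rho0.
  have := expR_scale_le (ln (rho y)) a0 a2.
  by rewrite lnK ?posrE// /powR gt_eqF.
rewrite integralD// integralD// integralD// !integralZl//.
rewrite w1 EL.
rewrite !EFinD [(a * L)%:E]EFinM; apply: leeD => //.
rewrite (_ : a ^+ 2 * (2 * Q + 16 * B) = a ^+ 2 * 2 * Q + a ^+ 2 * 16 * B)%R; last by ring.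
rewrite EFinD (EFinM (a ^+ 2 * 2) Q) (EFinM (a ^+ 2 * 16) B).
by apply: leeD; rewrite lee_wpmul2l// lee_fin mulr_ge0// sqr_ge0.
Qed.

End ratio.

(** * Uniform bounds on expectations under the true densities *)

Section expectations.
Context (R : realType) (V : normedModType R) (X : set V)
  (d : measure_display) (S : measurableType d) (mu : {sigma_finite_measure set S -> \bar R})
  (f0 : X -> S -> R) (M : R) (g : R -> S -> R).
Hypothesis dens : forall x, is_density mu (f0 x).
Hypothesis mg : measurable_fun setT (fun z : R * S => g z.1 z.2).
Hypothesis g0 : forall t y, 0 <= g t y.
Hypothesis HD : assumptionD mu f0 M g.

Let I (t : R) := t \in `[- M, M].

Lemma measurable_model t : measurable_fun setT (g t).
Proof.
apply: (@measurableT_comp _ _ _ _ _ _ (fun z : R * S => g z.1 z.2) _ (fun y => (t, y))) => //.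
exact: measurable_fun_pair.
Qed.

Let mgt := measurable_model.

(** The finiteness in [assumptionD] is used on the diagonal [t = t']. *)
Lemma model_support_ae x t : I t -> support_ae mu (f0 x) (g t).
Proof.
move=> It; have [mf f00 f01] := dens x.
apply: support_ae_llratio => //.
by have [[fin _] _ _] := HD; have := fin (x, t, t); apply.
Qed.

Lemma Ex_lratio1 x p q : (forall y, 0 <= p y) -> (forall y, 0 <= q y) ->
  Ex mu f0 x (fun y => lratio p q y `^ 1)%E = Ex mu f0 x (lratio p q).
Proof.
by move=> p0 q0; apply: eq_integral => y _; rewrite poweRe1// lratio_ge0.
Qed.

Lemma near_diagonal_Ex_lratio (eta : R) : compact X -> 0 < eta ->
  exists2 r : R, 0 < r & forall x t t', I t -> I t' -> `|t - t'| < r ->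
    (Ex mu f0 x (lratio (g t) (g t')) <= (expR eta)%:E)%E.
Proof.
move=> cX eta0; have [_ /(_ 1) H _] := HD.
have h01 : 0 <= (1 : R) <= 1 by rewrite ler01 /=.
have [fin cont] := H h01.
pose G z := fine (Ex mu f0 z.1.1 (fun y => lratio (g z.1.2) (g z.2) y `^ 1)%E).
have Gdiag x t : I t -> G (x, t, t) = 1.
  move=> It; have [mf f00 f01] := dens x.
  by rewrite /G /= /Ex integral_lratio_diag//; exact: model_support_ae.
have cK : compact ([set: X] `*` [set` `[- M, M]]).
  by apply: compact_setX; [exact: compact_setT_subtype|exact: segment_compact].
(* Compactness is used as a near covering along [r] tending to [0] from the right, which turns a
   radius for each [(x, t)] into a common one. Locally, [rho] is shared equally between the distance
   from [t] to [s] and the distance from [s] to [t']. *)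
move/compact_near_coveringP/near_covering_withinP : cK.
move=> /(_ R 0^'+ (fun r xt => forall t', I t' -> `|xt.2 - t'| < r ->
  G (xt, t') < expR eta) _) nc.
have {}nc : \forall r \near 0^'+, [set: X] `*` [set` `[- M, M]] `<=`
    (fun xt => forall t', I t' -> `|xt.2 - t'| < r -> G (xt, t') < expR eta).
  apply: nc => -[x t] [_ /= It].
  have /subspace_continuousP/(_ (x, t, t) (conj It It)) cxt := cont.
  have : \forall z \near within (@param_cube R V X M) (nbhs (x, t, t)), G z < expR eta.
    apply: (cvgr_lt (G (x, t, t))); first exact: cxt.
    by rewrite Gdiag// expR_gt1.
  rewrite /within /= => -[[N1 N2] /= [N1x /nbhs_ballP[rho /= rho0 N2t]] Nsub].
  exists ((N1 `&` [set z | `|t - z.2| < rho / 2]), [set r | r < rho / 2]) => /=.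
    split; first apply: filterI => //.
      have : \forall z \near (x, t), ball t (rho / 2) z.2.
        by apply: cvg_snd; apply: nbhsx_ballx; rewrite divr_gt0.
      by apply: filterS => z; rewrite -ball_normE.
    by apply: nbhs_right_lt; rewrite divr_gt0.
  move=> [[x' s] r] /= [[N1xs ts] r2] [_ Is] t' It' st'.
  apply: (Nsub (x', s, t')) => //; split => //=.
  apply: N2t; rewrite -ball_normE /=.
  by have := ler_distD s t t'; lra.
have [r /= r0 /(_ (r / 2)) P] := nc.
exists (r / 2); first by rewrite divr_gt0.
move=> x t t' It It' tt'.
have {}P : G (x, t, t') < expR eta.
  apply: P => //=; first by rewrite sub0r normrN gtr0_norm ?divr_gt0// ltr_pdivrMr//; lra.
  by rewrite divr_gt0.
rewrite -Ex_lratio1// -[leLHS]fineK; first by rewrite lee_fin ltW.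
by have := fin (x, t, t'); apply.
Qed.

Lemma Ex_lratio_bounded : compact X -> exists B : R, forall x t t', I t -> I t' ->
  (Ex mu f0 x (lratio (g t) (g t')) <= B%:E)%E.
Proof.
move=> cX; have [_ /(_ 1) H _] := HD.
have h01 : 0 <= (1 : R) <= 1 by rewrite ler01 /=.
have [fin cont] := H h01.
have cK : compact (@param_cube R V X M).
  rewrite (_ : param_cube M = ([set: X] `*` [set` `[- M, M]]) `*` [set` `[- M, M]]); last first.
    by apply/seteqP; split => -[[x t] t'] /= [] // [].
  by do 2?apply: compact_setX;
    [exact: compact_setT_subtype|exact: segment_compact|exact: segment_compact].
have /compact_bounded[B [_ HBd]] := continuous_compact cont cK.
exists (B + 1) => x t t' It It'.
have finx : Ex mu f0 x (lratio (g t) (g t')) \is a fin_num.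
  by rewrite -Ex_lratio1//; have := fin (x, t, t'); apply.
rewrite -(fineK finx) lee_fin; apply: le_trans (ler_norm _) _.
apply: (HBd (B + 1)); first by rewrite ltrDl.
by exists (x, t, t') => //=; rewrite Ex_lratio1.
Qed.

Lemma Ex_lratio_poweR_le : compact X -> exists2 K : R, 0 < K &
  forall x t t' (a : R), I t -> I t' -> 0 < a -> a <= 2^-1 ->
  (Ex mu f0 x (fun y => lratio (g t) (g t') y `^ a) <=
    (1 + a * fine (Ex mu f0 x (llratio (g t) (g t'))) + a ^+ 2 * K)%:E)%E.
Proof.
move=> cX; have [B HBd] := Ex_lratio_bounded cX.
have [[fin1 _] fin2 [C HC]] := HD.
(* [C] bounds the second moments of the log-ratios and [B] the expectations of the ratios; the
   absolute value and the [1] ensure positivity. *)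
exists (`|2 * C + 16 * B| + 1); first by rewrite ltr_pwDr.
move=> x t t' a It It' a0 a2; have [mf f00 f01] := dens x.
have st := model_support_ae x It; have st' := model_support_ae x It'.
have finL : Ex mu f0 x (llratio (g t) (g t')) \is a fin_num by have := fin1 (x, t, t'); apply.
have finA : Ex mu f0 x (fun y => lratio (g t) (g t') y `^ a)%E \is a fin_num.
  have a01 : 0 <= a <= 1 by apply/andP; split; lra.
  by have [fin _] := fin2 a a01; have := fin (x, t, t'); apply.
apply: le_trans (integral_lratio_poweR_le mf f00 f01 (mgt t) (g0 t) (mgt t') (g0 t')
  st st' a0 a2 finA (esym (fineK finL)) (HC (x, t, t') (conj It It')) (HBd _ _ _ It It')) _.
rewrite lee_fin lerD2l ler_wpM2l ?sqr_ge0//.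
by apply: le_trans (ler_norm _) _; rewrite lerDl.
Qed.

Lemma Ex_llratioN x t t' : I t -> I t' ->
  Ex mu f0 x (llratio (g t') (g t)) = (- Ex mu f0 x (llratio (g t) (g t')))%E.
Proof.
move=> It It'; have [mf f00 f01] := dens x.
apply: integral_llratioN => //; do ?exact: mgt; do ?exact: model_support_ae.
by have [[fin _] _ _] := HD; have := fin (x, t, t'); apply.
Qed.

Lemma Ex_llratio_fin x t t' : I t -> I t' ->
  Ex mu f0 x (llratio (g t) (g t')) \is a fin_num.
Proof. by move=> It It'; have [[fin _] _ _] := HD; have := fin (x, t, t'); apply. Qed.

(** Apply [assumptionE] with the distance from [t] to [thstar x] as its [e]: a negative divergence
    would lie below [del] and make that distance smaller than itself. At zero distance, antisymmetry
    of the log-ratio forces the value zero. *)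
Lemma Ex_llratio_ge0 (thstar : X -> R) x t : assumptionE mu f0 M g thstar ->
  I (thstar x) -> I t -> (0 <= Ex mu f0 x (llratio (g (thstar x)) (g t)))%E.
Proof.
move=> HE Is It; have [->|tx] := eqVneq t (thstar x).
  have fin := Ex_llratio_fin x Is Is.
  have := Ex_llratioN x Is Is; rewrite -(fineK fin) -EFinN => -[] e.
  by rewrite lee_fin; lra.
have /HE[del /andP[del0 _] H] : 0 < `|t - thstar x| by rewrite normr_gt0 subr_eq0.
rewrite leNgt; apply/negP => lt0.
by have := H x t It (lt_trans lt0 _); rewrite ltxx lte_fin; move=> /(_ del0).
Qed.

End expectations.

Lemma prode_le_expR (R : realType) (n : nat) (a : nat -> \bar R) (b : nat -> R) :
  (forall i, (i < n)%N -> 0 <= a i)%E ->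
  (forall i, (i < n)%N -> a i <= (expR (b i))%:E)%E ->
  (\prod_(i < n) a i <= (expR (\sum_(i < n) b i))%:E)%E.
Proof.
elim: n => [|n IH] a0 ab; first by rewrite !big_ord0 expR0.
rewrite !big_ord_recr /= expRD EFinM; apply: lee_pmul.
- by apply: prode_ge0 => i _; apply: a0; rewrite ltnS ltnW.
- exact: a0.
- by apply: IH => i ni; [apply: a0|apply: ab]; rewrite ltnS ltnW.
- exact: ab.
Qed.

Lemma poweR_prod (R : realType) (n : nat) (r : nat -> \bar R) (a : R) :
  (forall i, 0 <= r i)%E ->
  ((\prod_(i < n) r i) `^ a = \prod_(i < n) (r i `^ a))%E.
Proof.
move=> r0; elim: n => [|n IH]; first by rewrite !big_ord0 poweR1r.
by rewrite !big_ord_recr /= poweRM ?IH// prode_ge0.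
Qed.

(** * Likelihood ratios of independent responses and their mixtures *)

Section responses.
Context (R : realType) (V : normedModType R) (X : set V)
  (d : measure_display) (S : measurableType d)
  (mu : {sigma_finite_measure set S -> \bar R})
  (f0 : X -> S -> R) (M : R) (g : R -> S -> R).
Hypothesis dens : forall x, is_density mu (f0 x).
Hypothesis mg : measurable_fun setT (fun z : R * S => g z.1 z.2).
Hypothesis g0 : forall t y, 0 <= g t y.
Hypothesis HD : assumptionD mu f0 M g.
Context (xs : nat -> X) (d' : measure_display) (Omega : measurableType d')
  (P0 : probability Omega R) (Y : nat -> Omega -> S).
Hypothesis HY : independent_responses mu f0 P0 xs Y.

Let mY i : measurable_fun setT (Y i). Proof. by have [] := HY. Qed.

Lemma integral_response i (h : S -> \bar R) :
  measurable_fun setT h -> (forall y, 0 <= h y)%E ->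
  (\int[P0]_w h (Y i w) = Ex mu f0 (xs i) h)%E.
Proof.
move=> mh h0; have [mf f00 f01] := dens (xs i); have [_ law _] := HY.
transitivity (\int[P0]_w (h (Y i w) * cst 1%E w))%E.
  by apply: eq_integral => w _; rewrite mule1.
apply: (@ge0_integral_transfer _ _ _ _ _ _ _ P0 mu (Y i) id (cst 1%E)
  (fun y => (f0 (xs i) y)%:E)) => //; first exact/measurable_EFinP.
move=> B mB; transitivity (P0 (Y i @^-1` B)).
  transitivity (\int[P0]_w (\1_(Y i @^-1` B) w)%:E)%E.
    by apply: eq_integral => w _; rewrite mule1.
  rewrite integral_indic ?setIT// -[X in measurable X]setTI; exact: mY.
rewrite law// [LHS]integral_mkcond epatch_indic.
by apply: eq_integral => y _ /=; rewrite muleC.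
Qed.

(** Positive densities along the sample are what allows likelihood ratios to be inverted and
    chained. *)
Lemma ae_model_pos t i : t \in `[- M, M] -> {ae P0, forall w, 0 < g t (Y i w)}.
Proof.
move=> It; pose N := [set y | g t y <= 0].
have mN : measurable N.
  by rewrite -[N]setTI; apply: measurable_fun_le => //; exact: measurable_model.
have mYN : measurable (Y i @^-1` N) by rewrite -[X in measurable X]setTI; exact: mY.
exists (Y i @^-1` N); split => //; last by move=> w /= /negP; rewrite -leNgt.
transitivity (\int[P0]_w (\1_N (Y i w))%:E)%E.
  by rewrite (_ : (fun w => _) = fun w => (\1_(Y i @^-1` N) w)%:E)// integral_indic// setIT.
rewrite (@integral_response i (fun y => (\1_N y)%:E)); last 2 first.
- exact/measurable_EFinP.
- by move=> y; rewrite lee_fin.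
have [mf f00 f01] := dens (xs i).
rewrite /Ex; transitivity (\int[mu]_(y in [set: S]) (cst 0 y))%E; last by rewrite integral0.
apply: ae_eq_integral => //.
  by apply: emeasurable_funM; exact/measurable_EFinP.
apply: filterS (model_support_ae dens mg g0 HD (xs i) It) => y py _.
have [->|fy] := eqVneq (f0 (xs i) y) 0; first by rewrite mule0.
have {}fy : 0 < f0 (xs i) y by rewrite lt_def fy f00.
by rewrite indicE memNset ?mul0e// /N /=; apply/negP; rewrite -ltNge py.
Qed.

Lemma ae_model_pos_all (th : X -> R) : (forall x, th x \in `[- M, M]) ->
  {ae P0, forall w, forall i, 0 < g (th (xs i)) (Y i w)}.
Proof. by move=> thM; apply: ae_foralln => i; exact: ae_model_pos. Qed.

(** Parameters and responses all vary with [z], which covers functions of the sample, of the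
    parameter, and of both jointly as Tonelli's theorem demands. *)
Lemma measurable_likelihood dZ (Z : measurableType dZ) (a b : nat -> Z -> R)
    (y : nat -> Z -> S) n :
  (forall i, measurable_fun setT (a i)) -> (forall i, measurable_fun setT (b i)) ->
  (forall i, measurable_fun setT (y i)) ->
  measurable_fun setT (fun z => \prod_(i < n) lratio (g (a i z)) (g (b i z)) (y i z))%E.
Proof.
move=> ma mb my.
have mgc (c : nat -> Z -> R) i : measurable_fun setT (c i) ->
    measurable_fun setT (fun z => g (c i z) (y i z)).
  move=> mc; apply: (@measurableT_comp _ _ _ _ _ _ (fun z : R * S => g z.1 z.2) _
    (fun z => (c i z, y i z))) => //; exact: measurable_fun_pair.
apply: (@measurable_prode _ _ _ n (fun i z => lratio (g (a i z)) (g (b i z)) (y i z))) => i.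
by apply: (@measurable_lratio _ _ _ (fun z => g (a i z) (y i z)) (fun z => g (b i z) (y i z)));
  [exact: mgc|exact: mgc|move=> z].
Qed.

Lemma likelihood_ge0 th1 th2 y n : (0 <= likelihood g th1 xs y n th2)%E.
Proof. by apply: prode_ge0 => i _; exact: lratio_ge0. Qed.

Lemma integral_likelihood (th1 th2 : X -> R) n :
  (\int[P0]_w likelihood g th2 xs (fun i => Y i w) n th1 =
   \prod_(i < n) Ex mu f0 (xs i) (lratio (g (th1 (xs i))) (g (th2 (xs i)))))%E.
Proof.
have [_ _ indep] := HY.
rewrite (integral_prod_indep mY indep n
  (g := fun i => lratio (g (th1 (xs i))) (g (th2 (xs i))))).
- apply: eq_bigr => i _; rewrite integral_response//; last by move=> y; exact: lratio_ge0.
  by apply: measurable_lratio => //; exact: measurable_model.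
- by move=> i; apply: measurable_lratio => //; exact: measurable_model.
- by move=> i y; exact: lratio_ge0.
Qed.

Lemma integral_likelihood_poweR (th1 th2 : X -> R) n (a : R) :
  (\int[P0]_w (likelihood g th2 xs (fun i => Y i w) n th1 `^ a) =
   \prod_(i < n) Ex mu f0 (xs i)
     (fun y => lratio (g (th1 (xs i))) (g (th2 (xs i))) y `^ a))%E.
Proof.
have [_ _ indep] := HY.
have mr i : measurable_fun setT (fun y => lratio (g (th1 (xs i))) (g (th2 (xs i))) y `^ a)%E.
  apply: (measurableT_comp (measurable_poweR a)).
  by apply: measurable_lratio => //; exact: measurable_model.
transitivity (\int[P0]_w \prod_(i < n)
    (lratio (g (th1 (xs i))) (g (th2 (xs i))) (Y i w) `^ a))%E.
  apply: eq_integral => w _; rewrite /likelihood.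
  by rewrite (poweR_prod _ _ (r := fun i => lratio (g (th1 (xs i))) (g (th2 (xs i))) (Y i w)))//
    => i; exact: lratio_ge0.
rewrite (integral_prod_indep mY indep n
  (g := fun i y => lratio (g (th1 (xs i))) (g (th2 (xs i))) y `^ a)%E)//.
- apply: eq_bigr => i _.
  apply: (@integral_response i (fun y => lratio (g (th1 (xs i))) (g (th2 (xs i))) y `^ a)%E) => //.
  by move=> y; exact: poweR_ge0.
- by move=> i y; exact: poweR_ge0.
Qed.

Section mixture.
Context (Pi : probability (paramType X) R) (A : set (paramType X))
  (th1 th2 : paramType X -> X -> R) (n : nat).
Hypotheses (mA : measurable A) (mth1 : forall x, measurable_fun setT (th1 ^~ x))
  (mth2 : forall x, measurable_fun setT (th2 ^~ x)).

Let L (z : Omega * paramType X) : \bar R :=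
  (likelihood g (th2 z.2) xs (fun i => Y i z.1) n (th1 z.2) * (\1_A z.2)%:E)%E.

Let mL : measurable_fun setT L.
Proof.
apply: emeasurable_funM.
  apply: (measurable_likelihood (a := fun i (z : Omega * paramType X) => th1 z.2 (xs i))
    (b := fun i (z : Omega * paramType X) => th2 z.2 (xs i))
    (y := fun i (z : Omega * paramType X) => Y i z.1)) => i.
  - exact: (measurableT_comp (mth1 (xs i))).
  - exact: (measurableT_comp (mth2 (xs i))).
  - exact: (measurableT_comp (mY i)).
apply/measurable_EFinP.
by apply: (@measurableT_comp _ _ _ _ _ _ (\1_A : paramType X -> R)) => //; exact: measurable_indic.
Qed.

Let L0 z : (0 <= L z)%E.
Proof. by rewrite mule_ge0 ?likelihood_ge0// lee_fin. Qed.

Let mixE w : (\int[Pi]_(th in A) likelihood g (th2 th) xs (fun i => Y i w) n (th1 th) =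
  \int[Pi]_th L (w, th))%E.
Proof. by rewrite integral_mkcond epatch_indic. Qed.

Lemma measurable_mixture : measurable_fun setT (fun w =>
  \int[Pi]_(th in A) likelihood g (th2 th) xs (fun i => Y i w) n (th1 th))%E.
Proof. by under eq_fun do rewrite mixE; exact: measurable_fun_fubini_tonelli_F. Qed.

(** Tonelli exchanges the integrals, and independence factors the inner one into [n] terms of size
    at most [expR eta]. Both [th1] and [th2] depend on the mixing variable because the evidence
    bound mixes ratios of [thstar] to [th], the numerator bound ratios of [th] to a fixed [th0]. *)
Lemma integral_mixture_le (eta : R) :
  (forall th, A th -> forall x,
    Ex mu f0 x (lratio (g (th1 th x)) (g (th2 th x))) <= (expR eta)%:E)%E ->
  (\int[P0]_w \int[Pi]_(th in A) likelihood g (th2 th) xs (fun i => Y i w) n (th1 th)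
    <= (expR (n%:R * eta))%:E)%E.
Proof.
move=> bnd; under eq_integral do rewrite mixE.
rewrite (fubini_tonelli L)//.
apply: (@le_trans _ _ (\int[Pi]_th (cst (expR (n%:R * eta))%:E th))%E); last first.
  rewrite integral_cst// -[leRHS]mule1; apply: lee_wpmul2l; first by rewrite lee_fin expR_ge0.
  exact: probability_le1.
apply: ge0_le_integral => //.
- by move=> th _; exact: integral_ge0.
- exact: measurable_fun_fubini_tonelli_G.
- move=> th _; rewrite /L /=; have [Ath|nAth] := pselect (A th).
    rewrite indicE mem_set//; under eq_integral do rewrite mule1.
    rewrite integral_likelihood.
    apply: le_trans (prode_le_expR (b := fun=> eta)
      (a := fun i => Ex mu f0 (xs i) (lratio (g (th1 th (xs i))) (g (th2 th (xs i))))) _ _) _.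
    + move=> i _; apply: integral_ge0 => y _; rewrite mule_ge0 ?lratio_ge0// lee_fin.
      by have [_ + _] := dens (xs i); exact.
    + by move=> i _; exact: bnd.
    + by rewrite lee_fin sumr_const card_ord mulr_natl.
  rewrite indicE memNset//; under eq_integral do rewrite mule0.
  by rewrite integral0 lee_fin expR_ge0.
Qed.

End mixture.

End responses.

(** * Posterior concentration *)

Lemma lratio_EFin (R : realType) (d : measure_display) (T : measurableType d)
  (p q : T -> R) y : 0 < q y -> lratio p q y = (p y / q y)%:E.
Proof. by move=> q0; rewrite /lratio inver gt_eqF. Qed.

(** For [p y = 0] both sides are [+oo]. *)
Lemma lratioV (R : realType) (d : measure_display) (T : measurableType d)
  (p q : T -> R) y : 0 <= p y -> 0 < q y -> (lratio q p y = (lratio p q y)^-1)%E.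
Proof.
move=> p0 q0; rewrite (lratio_EFin p q0) /lratio !inver mulf_eq0 invr_eq0 (gt_eqF q0) orbF.
by case: ifPn => py; [rewrite gt0_muley|rewrite -EFinM invf_div].
Qed.

Lemma inveM_ge0 (R : realType) (a b : R) : 0 <= a -> 0 <= b ->
  (a%:E^-1 * b%:E^-1 = (a%:E * b%:E)^-1)%E.
Proof.
move=> a0 b0; rewrite -EFinM !inver mulf_eq0.
have [->|a1] := eqVneq a 0 => /=.
  have [_|b1] := eqVneq b 0; first by rewrite mulyy.
  by rewrite gt0_mulye// lte_fin invr_gt0 lt_def b1 b0.
have [_|b1] := eqVneq b 0; last by rewrite -EFinM invfM.
by rewrite gt0_muley// lte_fin invr_gt0 lt_def a1 a0.
Qed.

(** This is [(1 - c * l) ^+ 2 >= 0] divided by [l]; at [l = 0] the right-hand side is [+oo].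
    Integrated, it converts an upper bound on the mean of an inverse into a lower bound on the
    mean. *)
Lemma inve_ge_quad (R : realType) (l c : R) : 0 <= l ->
  ((2 * c)%:E <= l%:E^-1 + (c ^+ 2 * l)%:E)%E.
Proof.
move=> l0; rewrite inver; have [->|l1] := eqVneq l 0; first by rewrite mulr0 addye// leey.
have {l1}l0 : 0 < l by rewrite lt_def l1 l0.
rewrite -EFinD lee_fin -(ler_pM2r l0) [leRHS]mulrDl mulVf ?gt_eqF//.
by have := sqr_ge0 (1 - c * l); nra.
Qed.

(** * Lower bound for the evidence *)

Section evidence_lower_bound.
Context (R : realType) (V : normedModType R) (X : set V)
  (d : measure_display) (S : measurableType d)
  (mu : {sigma_finite_measure set S -> \bar R})
  (f0 : X -> S -> R) (M : R) (g : R -> S -> R).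
Hypothesis dens : forall x, is_density mu (f0 x).
Hypothesis mg : measurable_fun setT (fun z : R * S => g z.1 z.2).
Hypothesis g0 : forall t y, 0 <= g t y.
Hypothesis HD : assumptionD mu f0 M g.
Context (xs : nat -> X) (d' : measure_display) (Omega : measurableType d')
  (P0 : probability Omega R) (Y : nat -> Omega -> S).
Hypothesis HY : independent_responses mu f0 P0 xs Y.

Lemma likelihood_EFin (th1 th2 : X -> R) y n : (forall i, 0 < g (th2 (xs i)) (y i)) ->
  likelihood g th2 xs y n th1 =
  (\prod_(i < n) (g (th1 (xs i)) (y i) / g (th2 (xs i)) (y i)))%:E.
Proof.
move=> g2; rewrite -prodEFin; apply: eq_bigr => i _; exact: lratio_EFin.
Qed.

Lemma likelihoodV (th1 th2 : X -> R) y n : (forall i, 0 < g (th2 (xs i)) (y i)) ->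
  (likelihood g th1 xs y n th2 = (likelihood g th2 xs y n th1)^-1)%E.
Proof.
move=> g2; elim: n => [|n IH]; first by rewrite /likelihood !big_ord0 inve1.
move: IH; rewrite /likelihood !big_ord_recr /= => ->.
have := likelihood_EFin th1 n g2; rewrite /likelihood => ->.
rewrite lratioV// lratio_EFin// inveM_ge0//; last by rewrite divr_ge0// ltW.
by apply: prodr_ge0 => i _; rewrite divr_ge0// ltW.
Qed.

Lemma likelihood_chain (th1 th2 th3 : X -> R) y n :
  (forall i, 0 < g (th2 (xs i)) (y i)) -> (forall i, 0 < g (th3 (xs i)) (y i)) ->
  (likelihood g th3 xs y n th1 =
   likelihood g th3 xs y n th2 * likelihood g th2 xs y n th1)%E.
Proof.
move=> g2 g3; rewrite !likelihood_EFin// -EFinM -big_split /=; congr (_%:E).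
apply: eq_bigr => i _; rewrite [RHS]mulrC mulrA divfK// gt_eqF//; exact: g2.
Qed.

Variables (Theta : set (paramType X)) (Pi : probability (paramType X) R) (thstar : X -> R).
Hypothesis cX : compact X.
Hypothesis mTheta : measurable Theta.
Hypothesis ThetaM : forall th : X -> R, Theta th -> forall x, th x \in `[- M, M].
Hypothesis Tthstar : Theta thstar.

Let mlik_th n y : measurable_fun setT (fun th : paramType X => likelihood g thstar xs y n th).
Proof.
apply: (measurable_likelihood mg g0 (a := fun i (th : paramType X) => th (xs i))
  (b := fun i (th : paramType X) => thstar (xs i)) (y := fun i _ => y i)) => // i.
exact: measurable_eval_param.
Qed.

Lemma evidence_lower_bound (beta : R) :
  (forall r : R, 0 < r ->
    (0 < Pi [set th : paramType X | Theta th /\ (supdist th thstar < r)%R])%E) ->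
  0 < beta -> exists2 C : R, 0 < C & {ae P0, forall w, \forall n \near \oo,
    ((C * expR (- (n%:R * beta)))%:E <=
     \int[Pi]_(th in Theta) likelihood g thstar xs (fun i => Y i w) n th)%E}.
Proof.
move=> supp beta0; have b20 : 0 < beta / 2 by rewrite divr_gt0.
(* Half of [beta] bounds the moments; the other half is the slack for [ae_exp_bound]. *)
have [r r0 Hr] := near_diagonal_Ex_lratio dens mg g0 HD cX b20.
pose W := [set th : paramType X | Theta th /\ supdist th thstar < r].
have mW : measurable W := measurable_supdist_lt (xs 0%N) mTheta ThetaM Tthstar r.
have WTheta : W `<=` Theta by move=> th [].
have PW := supp r r0; rewrite -/W in PW.
have finW : Pi W \is a fin_num by exact: fin_num_measure.
pose pW := fine (Pi W).
have pW0 : 0 < pW by rewrite fine_gt0// PW -ge0_fin_numE.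
have mst x : measurable_fun setT (fun th : paramType X => thstar x) by [].
have mev x : measurable_fun setT (fun th : paramType X => (th : X -> R) x).
  exact: measurable_eval_param.
pose Z n w := (\int[Pi]_(th in W) likelihood g th xs (fun i => Y i w) n thstar)%E.
have mZ n : measurable_fun setT (Z n).
  exact: (measurable_mixture mg g0 HY Pi (th1 := fun=> thstar) n mW mst mev).
have Z0 n w : (0 <= Z n w)%E by apply: integral_ge0 => th _; exact: likelihood_ge0.
have EZ n : (\int[P0]_w Z n w <= (expR (n%:R * (beta / 2)))%:E)%E.
  have H := @integral_mixture_le _ _ _ _ _ _ _ _ dens mg g0 _ _ _ _ _ HY Pi W
    (fun=> thstar) (fun th => th) n mW mst mev (beta / 2).
  apply: H => th [Tth thr] x.
  apply: Hr; [exact: ThetaM|exact: ThetaM|].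
  by rewrite distrC; apply: le_lt_trans thr; exact: supdist_ge (ThetaM Tth) (ThetaM Tthstar) x.
have bb : beta / 2 < beta by rewrite ltr_pdivrMr// ltr_pMr// ltr1n.
have nEZ : \forall n \near \oo, (\int[P0]_w Z n w <= (expR (n%:R * (beta / 2)))%:E)%E.
  exact: nearW.
have aeZ := ae_exp_bound bb mZ Z0 nEZ; exists (pW ^+ 2); first by rewrite exprn_gt0.
have aepos := ae_model_pos_all dens mg g0 HD HY (ThetaM Tthstar).
apply: filterS (filterI aeZ aepos) => w [Zw pos]; apply: filterS Zw => n Zn.
set L := fun th : paramType X => likelihood g thstar xs (fun i => Y i w) n th.
have mL : measurable_fun setT L by exact: mlik_th.
have L0 th : (0 <= L th)%E by exact: likelihood_ge0.
have DW : (\int[Pi]_(th in W) L th <= \int[Pi]_(th in Theta) L th)%E.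
  by apply: ge0_subset_integral => //; exact: measurable_funTS.
apply: le_trans DW.
(* With this [c] the left-hand side of [key] is [2 * expR (n * beta)]. The term [Z n w] absorbs one
   half, and the other half divided by [c ^+ 2] is [pW ^+ 2 * expR (- (n * beta))]. *)
pose c := expR (n%:R * beta) / pW.
have c0 : 0 < c by rewrite divr_gt0// expR_gt0.
(* [2c <= 1/L + c^2 L], integrated over [W]. *)
have key : ((2 * c)%:E * Pi W <= Z n w + (c ^+ 2)%:E * \int[Pi]_(th in W) L th)%E.
  rewrite -integral_cst// -ge0_integralZl//; last 2 first.
  - exact: measurable_funTS.
  - by rewrite lee_fin sqr_ge0.
  rewrite -ge0_integralD//; last 4 first.
  - by move=> th _; exact: likelihood_ge0.
  - apply: measurable_funTS.
    apply: (measurable_likelihood mg g0 (a := fun i (th : paramType X) => thstar (xs i))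
      (b := fun i (th : paramType X) => th (xs i)) (y := fun i _ => Y i w)) => // i.
  - by move=> th _; rewrite mule_ge0// lee_fin sqr_ge0.
  - by apply: measurable_funTS; exact: measurable_funeM.
  apply: ge0_le_integral => //.
  - by move=> th _; rewrite lee_fin mulr_ge0// ltW.
  - apply: measurable_funTS; apply: emeasurable_funD; last exact: measurable_funeM.
    apply: (measurable_likelihood mg g0 (a := fun i (th : paramType X) => thstar (xs i))
      (b := fun i (th : paramType X) => th (xs i)) (y := fun i _ => Y i w)) => // i.
  - move=> th _; rewrite (likelihoodV th n pos) /L likelihood_EFin// -EFinM.
    apply: inve_ge_quad.
    by apply: prodr_ge0 => i _; rewrite divr_ge0// ltW.
have {key} : ((2 * c)%:E * Pi W <=
    (expR (n%:R * beta))%:E + (c ^+ 2)%:E * \int[Pi]_(th in W) L th)%E.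
  by apply: le_trans key _; exact: leeD.
rewrite -(fineK finW) -/pW -EFinM.
have cpW : c * pW = expR (n%:R * beta) by rewrite /c divfK// gt_eqF.
have : (0 <= \int[Pi]_(th in W) L th)%E by exact: integral_ge0.
case: (\int[Pi]_(th in W) L th)%E => [D| |]//.
- rewrite !lee_fin => D0; rewrite -mulrA cpW => H.
  have {}H : expR (n%:R * beta) <= c ^+ 2 * D by lra.
  rewrite expRN -ler_pdivlMr ?invr_gt0 ?expR_gt0// invrK.
  rewrite -(ler_pM2l (exprn_gt0 2 c0)).
  rewrite -exprMn cpW mulrA expr2 ler_pM2r ?expR_gt0//.
- by move=> _ _; rewrite leey.
Qed.

End evidence_lower_bound.

(** The limit inferior is the limit of the infima over tails, so one of these infima is positive; it
    serves as [k]. *)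
Lemma kappa_lower_bound (R : realType) (V : normedModType R) (X : set V)
    (xs : nat -> X) (x0 : X) (r : R) : (0 < kappa xs x0 r)%E ->
  exists2 k : R, 0 < k & \forall n \near \oo, n%:R * k <=
    \sum_(i < n) \1_([set x : X | `|set_val x - set_val x0| < r]) (xs i).
Proof.
rewrite /kappa limn_einf_lim; set u := fun n => _ => k0.
have [n en] : exists n, (0 < einfs u n)%E.
  apply: contrapT => /forallNP H; move: k0; apply/negP; rewrite -leNgt.
  apply: lime_le; first exact: is_cvg_einfs.
  by apply: nearW => n; rewrite leNgt; apply/negP/H.
have eu m : (n <= m)%N -> (einfs u n <= u m)%E.
  by move=> nm; apply: ereal_inf_lbound; exists m.
have fe : einfs u n \is a fin_num.
  rewrite ge0_fin_numE ?ltW//; apply: le_lt_trans (eu n (leqnn n)) _; exact: ltry.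
exists (fine (einfs u n)); first by rewrite fine_gt0// en -ge0_fin_numE// ltW.
(* Starting at [n.+1] keeps [m] positive, so the factor [m^-1] can be cleared. *)
exists n.+1 => // m /= nm; have := eu m (ltnW nm).
rewrite -{1}(fineK fe) lee_fin => H.
have m0 : 0 < m%:R :> R by rewrite ltr0n (leq_trans _ nm).
by move: H; rewrite ler_pdivlMl.
Qed.

Lemma continuous_sep_radius (R : realType) (V : normedModType R) (X : set V)
    (th1 th2 : X -> R) (x0 : X) (e : R) : continuous th1 -> continuous th2 ->
  e < `|th1 x0 - th2 x0| ->
  exists2 r : R, 0 < r &
    forall x : X, `|set_val x - set_val x0| < r -> e < `|th1 x - th2 x|.
Proof.
move=> c1 c2 ex0.
have : \forall x \near x0, e < `|th1 x - th2 x|.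
  have H : `|th1 x - th2 x| @[x --> x0] --> `|th1 x0 - th2 x0|.
    exact: (cvg_norm (cvgB (c1 x0) (c2 x0))).
  exact: (cvgr_gt _ H).
move=> [_ [[W oW <-] /= Wx0] Wsub].
have /nbhs_ballP[r /= r0 rW] : nbhs (set_val x0) W by exact: open_nbhs_nbhs.
exists r => // x xr; apply: Wsub => /=; apply: rW.
by rewrite -ball_normE /= distrC.
Qed.

(** * Exponential decay near a parameter away from [thstar] *)

Section local_consistency.
Context (R : realType) (V : normedModType R) (X : set V)
  (d : measure_display) (S : measurableType d)
  (mu : {sigma_finite_measure set S -> \bar R})
  (f0 : X -> S -> R) (M : R) (g : R -> S -> R).
Hypothesis dens : forall x, is_density mu (f0 x).
Hypothesis mg : measurable_fun setT (fun z : R * S => g z.1 z.2).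
Hypothesis g0 : forall t y, 0 <= g t y.
Hypothesis HD : assumptionD mu f0 M g.
Context (xs : nat -> X) (d' : measure_display) (Omega : measurableType d')
  (P0 : probability Omega R) (Y : nat -> Omega -> S).
Hypothesis HY : independent_responses mu f0 P0 xs Y.
Variable thstar : X -> R.
Hypotheses (cX : compact X) (HB : assumptionB xs) (HE : assumptionE mu f0 M g thstar).
Hypotheses (thstarM : forall x, thstar x \in `[- M, M]) (cthstar : continuous thstar).

Lemma likelihood_upper_bound (th0 : X -> R) (x0 : X) (e : R) :
  (forall x, th0 x \in `[- M, M]) -> continuous th0 -> 0 < e -> e < `|th0 x0 - thstar x0| ->
  exists2 gamma : R, 0 < gamma & {ae P0, forall w, \forall n \near \oo,
    (likelihood g thstar xs (fun i => Y i w) n th0 <= (expR (- (n%:R * gamma)))%:E)%E}.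
Proof.
move=> th0M cth0 e0 ex0.
have [r r0 sep] := continuous_sep_radius cth0 cthstar ex0.
have [del /andP[del0 _] Hdel] := HE e0.
have [k k0 freq] := kappa_lower_bound (HB x0 r0).
have [K K0 HK] := Ex_lratio_poweR_le dens mg g0 HD cX.
pose A := [set x : X | `|set_val x - set_val x0| < r].
(* The exponent is so small that the second order cost [a ^+ 2 * K] is at most half of the average
   gain [a * del * k]. *)
pose a := Num.min (2^-1) (del * k / (2 * K)).
have a0 : 0 < a.
  by rewrite lt_min; apply/andP; split; [lra|rewrite divr_gt0 ?mulr_gt0].
have a2 : a <= 2^-1 by rewrite ge_min lexx.
have aK : a * K <= del * k / 2.
  have : a <= del * k / (2 * K) by rewrite ge_min lexx orbT.
  rewrite ler_pdivlMr ?mulr_gt0// => H.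
  by rewrite ler_pdivlMr//; lra.
(* The drift of the log-ratio is at most [- del] on visits to [A], by the contrapositive of
   [assumptionE], and at most [0] elsewhere. *)
pose b i := - (a * del * \1_A (xs i)) + a ^+ 2 * K.
have Eb i : (Ex mu f0 (xs i) (fun y => lratio (g (th0 (xs i))) (g (thstar (xs i))) y `^ a)
    <= (expR (b i))%:E)%E.
  apply: le_trans (HK _ _ _ _ (th0M _) (thstarM _) a0 a2) _.
  rewrite lee_fin; apply: le_trans (expR_ge1Dx _).
  rewrite -addrA lerD2l lerD2r.
  rewrite (Ex_llratioN dens mg g0 HD (xs i) (thstarM _) (th0M _)).
  have fin := Ex_llratio_fin HD (xs i) (thstarM (xs i)) (th0M (xs i)).
  rewrite fineN mulrN lerN2 -mulrA ler_pM2l// indicE.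
  have [xA|xA] := boolP (xs i \in A); rewrite ?mulr1 ?mulr0; last first.
    by rewrite fine_ge0//; exact: Ex_llratio_ge0 HE (thstarM _) (th0M _).
  rewrite -lee_fin (fineK fin) leNgt; apply/negP => /(Hdel _ _ (th0M _)).
  by apply/negP; rewrite -leNgt ltW//; apply: sep; rewrite inE in xA.
pose c := a * del * k / 2.
have c0 : 0 < c by rewrite divr_gt0// !mulr_gt0.
pose Z n w := (likelihood g thstar xs (fun i => Y i w) n th0 `^ a)%E.
have mY i : measurable_fun setT (Y i) by have [] := HY.
have mZ n : measurable_fun setT (Z n).
  apply: (measurableT_comp (measurable_poweR a)).
  exact: (measurable_likelihood mg g0 (a := fun i _ => th0 (xs i))
    (b := fun i _ => thstar (xs i)) (y := fun i w => Y i w)).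
have EZ : \forall n \near \oo, (\int[P0]_w Z n w <= (expR (n%:R * - c))%:E)%E.
  apply: filterS freq => n Hn.
  rewrite (integral_likelihood_poweR dens mg g0 HY th0 thstar n a).
  apply: le_trans (prode_le_expR (b := b) (a := fun i => Ex mu f0 (xs i) (fun y =>
      lratio (g (th0 (xs i))) (g (thstar (xs i))) y `^ a)%E) _ _) _.
  - move=> i _; apply: integral_ge0 => y _; rewrite mule_ge0 ?poweR_ge0// lee_fin.
    by have [_ + _] := dens (xs i); exact.
  - by move=> i _; exact: Eb.
  rewrite lee_fin ler_expR /b big_split /= sumrN -mulr_sumr sumr_const card_ord -[_ *+ n]mulr_natl.
  have H1 : a * del * (n%:R * k) <= a * del * (\sum_(i < n) \1_A (xs i)).
    by rewrite ler_wpM2l// ltW// mulr_gt0.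
  have H2 : n%:R * (a ^+ 2 * K) <= n%:R * (a * (del * k / 2)).
    by rewrite ler_wpM2l// expr2 -mulrA ler_wpM2l// ltW.
  rewrite /c; lra.
have cc : - c < - (c / 2) by rewrite ltrN2 ltr_pdivrMr// ltr_pMr// ltr1n.
(* Half of [c] is given up to [ae_exp_bound]; dividing by [a] undoes the power. *)
exists (c / 2 / a); first by rewrite divr_gt0// divr_gt0.
apply: filterS (ae_exp_bound cc mZ (fun n w => poweR_ge0 _ _) EZ) => w.
apply: filterS => n Zn.
have -> : likelihood g thstar xs (fun i => Y i w) n th0 = (Z n w `^ a^-1)%E.
  by rewrite /Z -poweRrM divff ?gt_eqF// poweRe1// likelihood_ge0.
apply: le_trans (gt0_ler_poweR _ _ _ Zn) _.
- by rewrite invr_ge0 ltW.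
- by rewrite in_itv /= leey andbT poweR_ge0.
- by rewrite in_itv /= leey andbT lee_fin expR_ge0.
rewrite poweR_EFin -expRM lee_fin ler_expR.
by rewrite mulrN mulNr lerN2 !mulrA.
Qed.

Variables (Theta : set (paramType X)) (Pi : probability (paramType X) R).
Hypothesis mTheta : measurable Theta.
Hypothesis ThetaM : forall th : X -> R, Theta th -> forall x, th x \in `[- M, M].
Hypothesis ThetaC : forall th : X -> R, Theta th -> continuous th.
Hypothesis Tthstar : Theta thstar.

Lemma evidence_upper_bound (th0 : X -> R) (x0 : X) (e : R) :
  Theta th0 -> 0 < e -> e < `|th0 x0 - thstar x0| ->
  exists r gamma : R, [/\ 0 < r, 0 < gamma & forall A : set (paramType X),
    measurable A -> A `<=` Theta -> A `<=` unif_ball th0 r ->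
    {ae P0, forall w, \forall n \near \oo,
      (\int[Pi]_(th in A) likelihood g thstar xs (fun i => Y i w) n th <=
        (expR (- (n%:R * gamma)))%:E)%E}].
Proof.
move=> Tth0 e0 ex0.
have [gamma gamma0 Hg] := likelihood_upper_bound (ThetaM Tth0) (ThetaC Tth0) e0 ex0.
(* Moments of the mixture at rate [gamma / 4] give almost sure growth at rate at most [gamma / 2].
   Against the decay [gamma] of the likelihood of [th0] this leaves [gamma / 2]. *)
have eta0 : 0 < gamma / 4 by rewrite divr_gt0.
have [r r0 Hr] := near_diagonal_Ex_lratio dens mg g0 HD cX eta0.
exists r, (gamma / 2); split => //; first by rewrite divr_gt0.
move=> A mA ATheta Ar.
have mst x : measurable_fun setT (fun th : paramType X => th0 x) by [].
have mev x : measurable_fun setT (fun th : paramType X => (th : X -> R) x).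
  exact: measurable_eval_param.
pose Z n w := (\int[Pi]_(th in A) likelihood g th0 xs (fun i => Y i w) n th)%E.
have mZ n : measurable_fun setT (Z n).
  exact: (measurable_mixture mg g0 HY Pi (th2 := fun=> th0) n mA mev mst).
have Z0 n w : (0 <= Z n w)%E by apply: integral_ge0 => th _; exact: likelihood_ge0.
have EZ : \forall n \near \oo, (\int[P0]_w Z n w <= (expR (n%:R * (gamma / 4)))%:E)%E.
  apply: nearW => n.
  have H := @integral_mixture_le _ _ _ _ _ _ _ _ dens mg g0 _ _ _ _ _ HY Pi A
    (fun th => th) (fun=> th0) n mA mev mst (gamma / 4).
  apply: H => th Ath x.
  by apply: Hr; [exact: ThetaM (ATheta _ Ath) x|exact: ThetaM|exact: Ar].
have gg : gamma / 4 < gamma / 2 by lra.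
have aepos0 := ae_model_pos_all dens mg g0 HD HY (ThetaM Tth0).
have aepos := ae_model_pos_all dens mg g0 HD HY thstarM.
apply: filterS (filterI (filterI Hg (ae_exp_bound gg mZ Z0 EZ)) (filterI aepos0 aepos)).
move=> w [[Hgw Zw] [pos0 pos]]; apply: filterS (filterI Hgw Zw) => n [Hn Zn].
under eq_integral do rewrite (likelihood_chain _ n pos0 pos).
rewrite ge0_integralZl//; last 3 first.
- apply: measurable_funTS.
  apply: (measurable_likelihood mg g0 (a := fun i (th : paramType X) => th (xs i))
      (b := fun i (th : paramType X) => th0 (xs i)) (y := fun i _ => Y i w)) => //.
- by move=> th _; exact: likelihood_ge0.
- exact: likelihood_ge0.
apply: le_trans (lee_pmul _ _ Hn Zn) _; [exact: likelihood_ge0|exact: Z0|].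
rewrite -EFinM -expRD lee_fin ler_expR; lra.
Qed.

(** The radius is fixed before [A], so that a finite cover by such balls can afterwards be cut into
    disjoint measurable pieces. *)
Lemma posterior_near (th0 : X -> R) (e : R) :
  (forall r : R, 0 < r ->
    (0 < Pi [set th : paramType X | Theta th /\ (supdist th thstar < r)%R])%E) ->
  Theta th0 -> 0 < e -> exists2 r : R, 0 < r & forall A : set (paramType X),
    measurable A -> A `<=` [set th : paramType X | Theta th /\ supdist th thstar > e] ->
    A `<=` unif_ball th0 r ->
    {ae P0, forall w, posterior g Theta Pi thstar xs (fun i => Y i w) n A @[n --> \oo] --> 0%E}.
Proof.
move=> supp Tth0 e0.
have e20 : 0 < e / 2 by rewrite divr_gt0.
(* If [th0] stays within [e / 2] of [thstar] everywhere, its ball of radius [e / 2] contains no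
   parameter at distance more than [e], so [A] is empty. *)
have [[x0 ex0]|far] := pselect (exists x, e / 2 < `|th0 x - thstar x|); last first.
  exists (e / 2) => // A mA AU Ar.
  have -> : A = set0.
    rewrite -subset0 => th Ath; have [Tth] := AU th Ath.
    move/(supdist_gtP (ThetaM Tth) thstarM (xs 0%N)) => [x ex]; apply: far; exists x.
    have := Ar th Ath x; have := ler_distD (th0 x) (th x) (thstar x); lra.
  apply: aeW => w; rewrite /posterior; under eq_fun do rewrite integral_set0 mul0e.
  exact: cvg_cst.
have [r [gamma [r0 gamma0 HA]]] := evidence_upper_bound Tth0 e20 ex0.
(* Evidence bounded below at half the decay rate of the numerator leaves a quotient of order
   [expR (- (n * gamma / 2))]. *)
have g20 : 0 < gamma / 2 by rewrite divr_gt0.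
have [C C0 HC] := evidence_lower_bound dens mg g0 HD HY cX mTheta ThetaM Tthstar supp g20.
exists r => // A mA AU Ar.
have AT : A `<=` Theta by move=> th /AU[].
apply: filterS (filterI (HA A mA AT Ar) HC) => w [num den].
apply: (@squeeze_cvge _ _ _ _ (cst 0%E) _ (fun n => (C^-1 * expR (- (gamma / 2)) ^+ n)%:E)).
- apply: filterS (filterI num den) => n [Hn Hd].
  have D0 : 0 < C * expR (- (n%:R * (gamma / 2))) by rewrite mulr_gt0 ?expR_gt0.
  have DE0 : (0 <= \int[Pi]_(th in Theta) likelihood g thstar xs (fun i => Y i w) n th)%E.
    by apply: integral_ge0 => th _; exact: likelihood_ge0.
  have N0 : (0 <= \int[Pi]_(th in A) likelihood g thstar xs (fun i => Y i w) n th)%E.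
    by apply: integral_ge0 => th _; exact: likelihood_ge0.
  rewrite /posterior /cst mule_ge0 ?inve_ge0//=.
  apply: (@le_trans _ _ ((expR (- (n%:R * gamma)))%:E *
      (C * expR (- (n%:R * (gamma / 2))))%:E^-1)%E).
    apply: lee_pmul => //; first by rewrite inve_ge0.
    by rewrite lee_pV2// inE lee_fin ltW.
  rewrite inver gt_eqF// -EFinM lee_fin invfM mulrCA ler_pM2l ?invr_gt0//.
  rewrite -expRN -expRD -expRM_natl ler_expR; lra.
- exact: cvg_cst.
- apply: cvg_EFin; first exact: nearW.
  have q1 : `|expR (- (gamma / 2))| < 1.
    by rewrite gtr0_norm ?expR_gt0// expR_lt1 oppr_lt0.
  exact: (cvg_geometric C^-1 q1).
Qed.

End local_consistency.

(** * From local to global concentration by a finite cover *)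

Section global_consistency.
Context (R : realType) (V : normedModType R) (X : set V)
  (d : measure_display) (S : measurableType d)
  (mu : {sigma_finite_measure set S -> \bar R})
  (f0 : X -> S -> R) (M : R) (g : R -> S -> R).
Hypothesis dens : forall x, is_density mu (f0 x).
Hypothesis mg : measurable_fun setT (fun z : R * S => g z.1 z.2).
Hypothesis g0 : forall t y, 0 <= g t y.
Hypothesis HD : assumptionD mu f0 M g.
Context (xs : nat -> X) (d' : measure_display) (Omega : measurableType d')
  (P0 : probability Omega R) (Y : nat -> Omega -> S).
Hypothesis HY : independent_responses mu f0 P0 xs Y.
Variables (Theta : set (paramType X)) (Pi : probability (paramType X) R) (thstar : X -> R).
Hypotheses (HTheta : param_class M Theta) (HA : assumptionA Theta).
Hypotheses (HB : assumptionB xs) (HE : assumptionE mu f0 M g thstar).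
Hypothesis Tthstar : Theta thstar.
Hypothesis supp : forall r : R, 0 < r ->
  (0 < Pi [set th : paramType X | Theta th /\ (supdist th thstar < r)%R])%E.

Lemma posterior_setU (A B : set (paramType X)) y n : measurable A -> measurable B ->
  [disjoint A & B]%classic ->
  (posterior g Theta Pi thstar xs y n (A `|` B) =
   posterior g Theta Pi thstar xs y n A + posterior g Theta Pi thstar xs y n B)%E.
Proof.
move=> mA mB AB; rewrite /posterior ge0_integral_setU//.
- by rewrite ge0_muleDl//; apply: integral_ge0 => th _; exact: likelihood_ge0.
- apply: measurable_funTS.
  apply: (measurable_likelihood mg g0 (a := fun i (th : paramType X) => th (xs i))
    (b := fun i (th : paramType X) => thstar (xs i)) (y := fun i _ => y i)) => // i.
  exact: measurable_eval_param.
- by move=> th _; exact: likelihood_ge0.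
Qed.

Lemma posterior_consistent (e : R) : 0 < e ->
  {ae P0, forall w, posterior g Theta Pi thstar xs (fun i => Y i w) n
    [set th : paramType X | Theta th /\ supdist th thstar > e] @[n --> \oo] --> 0%E}.
Proof.
move=> e0; have [cX cTheta] := HA.
have mTheta : measurable Theta by exact: compact_measurable_param.
have ThetaM th : Theta th -> forall x, th x \in `[- M, M] by move=> /HTheta[].
have ThetaC th : Theta th -> continuous (th : X -> R) by move=> /HTheta[].
set U := [set th : paramType X | _].
have mU : measurable U := measurable_supdist_gt (xs 0%N) mTheta ThetaM Tthstar e.
have [r Hr] : {r : {uniform X -> R} -> R & forall th0, Theta th0 -> 0 < r th0 /\
    forall A : set (paramType X), measurable A -> A `<=` U -> A `<=` unif_ball th0 (r th0) ->
    {ae P0, forall w, posterior g Theta Pi thstar xs (fun i => Y i w) n A @[n --> \oo] --> 0%E}}.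
  apply: (@choice _ _ (fun th0 r => Theta th0 -> 0 < r /\
    forall A : set (paramType X), measurable A -> A `<=` U -> A `<=` unif_ball th0 r ->
    {ae P0, forall w, posterior g Theta Pi thstar xs (fun i => Y i w) n A @[n --> \oo] --> 0%E})).
  move=> th0; have [Tth0|nT] := pselect (Theta th0); last by exists 0.
  have [r r0 H] := posterior_near dens mg g0 HD HY cX HB HE (ThetaM _ Tthstar)
    (ThetaC _ Tthstar) mTheta ThetaM ThetaC Tthstar supp Tth0 e0.
  by exists r => _; split.
pose O th0 : set {uniform X -> R} := (unif_ball th0 (r th0) : set {uniform X -> R})°.
have mO th0 : measurable (O th0 : set (paramType X)).
  by apply: open_paramType; exact: open_interior.
(* Induction on the list of centers. [A] is cut into its part inside [O th0] and the rest, on which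
   the posterior is additive; [A] stays general because the rest is a new set. *)
have claim (s : seq {uniform X -> R}) : forall A : set (paramType X), measurable A -> A `<=` U ->
    A `<=` [set th | exists2 th0, th0 \in s & Theta th0 /\ O th0 th] ->
    {ae P0, forall w, posterior g Theta Pi thstar xs (fun i => Y i w) n A @[n --> \oo] --> 0%E}.
  elim: s => [|th0 s IH] A mA AU As.
    have -> : A = set0 by rewrite -subset0 => th /As[].
    apply: aeW => w; rewrite /posterior; under eq_fun do rewrite integral_set0 mul0e.
    exact: cvg_cst.
  have [Tth0|nTth0] := pselect (Theta th0); last first.
    apply: IH => // th /As[th1]; rewrite in_cons => /orP[/eqP->[]//|ths ?].
    by exists th1.
  have [r0 H0] := Hr th0 Tth0.
  have m1 : measurable (A `&` O th0) by exact: measurableI.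
  have m2 : measurable (A `\` O th0) by exact: measurableD.
  have H1 := H0 _ m1 (subset_trans (@subIsetl _ _ _) AU)
    (subset_trans (@subIsetr _ _ _) (@interior_subset _ _)).
  have H2 := IH (A `\` O th0) m2 (subset_trans (@subDsetl _ _ _) AU).
  have {}H2 : {ae P0, forall w, posterior g Theta Pi thstar xs (fun i => Y i w) n
      (A `\` O th0) @[n --> \oo] --> 0%E}.
    apply: H2 => th [Ath nO].
    have [th1] := As th Ath; rewrite in_cons => /orP[/eqP->[]//|ths Oth].
    by exists th1.
  apply: filterS (filterI H1 H2) => w [c1 c2].
  have dAO : [disjoint A `&` O th0 & A `\` O th0]%classic.
    by apply/disj_setPS => th [[_ ?] [_]].
  have AE : A = (A `&` O th0) `|` (A `\` O th0).
    by apply/seteqP; split => th; [have [] := pselect (O th0 th); [left|right]|case=> -[]].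
  rewrite [in X in X --> _](_ : (fun n => _) = (fun n =>
      posterior g Theta Pi thstar xs (fun i => Y i w) n (A `&` O th0) +
      posterior g Theta Pi thstar xs (fun i => Y i w) n (A `\` O th0)))%E; last first.
    by apply/funext => n; rewrite -posterior_setU// -AE.
  by rewrite -[X in _ --> X]adde0; exact: cvgeD c1 c2.
have [s cov] : exists s : seq {uniform X -> R},
    Theta `<=` [set th | exists2 th0, th0 \in s & Theta th0 /\ O th0 th].
  (* Lists of centers form a filter under inclusion. A near covering of [Theta] along it yields one
     finite list that works for every parameter. *)
  pose F := filter_from setT
    (fun s : seq {uniform X -> R} => [set s' : seq {uniform X -> R} | {subset s <= s'}]).
  have FF : Filter F.
    apply: filter_from_filter; first by exists [::].
    move=> s1 s2 _ _; exists (s1 ++ s2) => // s' H; split=> th ths; apply: H;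
      by rewrite mem_cat ths ?orbT.
  have /compact_near_coveringP nc := cTheta.
  have [|s _ Hs] := nc _ F (fun s th => exists2 th0, th0 \in s & Theta th0 /\ O th0 th) FF.
    move=> th Tth; exists (O th, [set s' : seq {uniform X -> R} | {subset [:: th] <= s'}]) => /=.
      split; last by exists [:: th].
      apply: open_nbhs_nbhs; split; first exact: open_interior.
      by apply: nbhs_unif_ball; case: (Hr th Tth).
    by move=> [th' s'] /= [Oth' ths]; exists th; first by apply: ths; rewrite mem_head.
  by exists s; apply: Hs.
by apply: (claim s) => // th [Tth _]; exact: cov.
Qed.

End global_consistency.

(* [f] is only a family of densities on [[-M, M]]; precomposing with [clamp]
   extends it to a jointly measurable nonnegative family on the real line. *)
Section clamp.
Context (R : realType) (M : R).

Definition clamp (t : R) : R := Num.max (- M) (Num.min M t).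

Lemma clampE t : t \in `[- M, M] -> clamp t = t.
Proof. by rewrite in_itv /= /clamp => /andP[Mt tM]; rewrite (min_idPr tM) (max_idPr Mt). Qed.

Lemma clamp_itv t : 0 <= M -> clamp t \in `[- M, M].
Proof.
by move=> M0; rewrite in_itv /= /clamp le_max lexx /= ge_max ge_min lexx andbT ge0_cp.
Qed.

Lemma measurable_clamp : measurable_fun setT clamp.
Proof. by apply: measurable_maxr => //; exact: measurable_minr. Qed.

End clamp.

Lemma cube_continuous_eq (R : realType) (V : normedModType R) (X : set V) (M : R)
    (h1 h2 : X * R * R -> \bar R) : (forall z, param_cube M z -> h1 z = h2 z) ->
  cube_continuous M h1 -> cube_continuous M h2.
Proof.
move=> E [fin cont]; split => [z Kz|]; first by rewrite -E//; exact: fin.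
apply: subspace_eq_continuous cont => z /set_mem Kz.
by rewrite /from_subspace E.
Qed.

Theorem theorem9 (R : realType) (V : normedModType R) (X : set V)
    (d : measure_display) (S : measurableType d)
    (mu : {sigma_finite_measure set S -> \bar R})
    (f0 : X -> S -> R) (M : R) (f : R -> S -> R)
    (Theta : set (paramType X)) (Pi : probability (paramType X) R)
    (thstar : X -> R) (xs : nat -> X)
    (d' : measure_display) (Omega : measurableType d')
    (P0 : probability Omega R) (Y : nat -> Omega -> S)
    (Hmodel : density_model mu f0 M f)
    (HTheta : param_class M Theta)
    (HPi : Pi Theta = 1%E)
    (HY : independent_responses mu f0 P0 xs Y)
    (HA : assumptionA Theta)
    (HB : assumptionB xs)
    (HC : assumptionC mu f0 M f Theta Pi thstar)
    (HD : assumptionD mu f0 M f)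
    (HE : assumptionE mu f0 M f thstar)
    (e : R) (He : 0 < e) :
  {ae P0, forall w : Omega,
    posterior f Theta Pi thstar xs (fun i => Y i w) n
      [set th : paramType X | Theta th /\ supdist th thstar > e]
      @[n --> \oo] --> 0%E}.
Proof.
have [dens fdens mf] := Hmodel; have [Tthstar _ supp] := HC.
have ThetaM th : Theta th -> forall x, th x \in `[- M, M] by move=> /HTheta[].
(* The value of [thstar] at the first design point shows that the interval is nonempty. *)
have M0 : 0 <= M.
  by have := ThetaM _ Tthstar (xs 0%N); rewrite in_itv /= => /andP[]; lra.
pose g t := f (clamp M t).
have gE t : t \in `[- M, M] -> g t = f t by move=> It; rewrite /g clampE.
have mg : measurable_fun setT (fun z : R * S => g z.1 z.2).
  apply: (@measurable_comp _ _ _ _ _ _ ([set t : R | t \in `[- M, M]] `*` [set: S])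
    (fun z : R * S => f z.1 z.2) _ (fun z => (clamp M z.1, z.2))).
  - by apply: measurableX => //; exact: measurable_itv.
  - by move=> _ [z _ <-]; split => //=; exact: clamp_itv.
  - exact: mf.
  - apply: measurable_fun_pair => //; apply: measurableT_comp => //; exact: measurable_clamp.
have g0 t y : 0 <= g t y by have [_ + _] := fdens _ (clamp_itv t M0); exact.
have gHD : assumptionD mu f0 M g.
  have [H1 H2 [C HC3]] := HD; split.
  - by apply: cube_continuous_eq H1 => z [It It']; rewrite !gE.
  - by move=> a a01; apply: cube_continuous_eq (H2 a a01) => z [It It']; rewrite !gE.
  - by exists C => z [It It']; rewrite !gE//; apply: HC3.
have gHE : assumptionE mu f0 M g thstar.
  move=> eps /HE[del del01 H]; exists del => // x t It.
  by rewrite !gE//; [exact: H|exact: ThetaM].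
(* Both integrals in the posterior range over subsets of [Theta], whose members take values where
   [f] and [g] agree. *)
have likE y n th : Theta th -> likelihood f thstar xs y n th = likelihood g thstar xs y n th.
  by move=> Tth; apply: eq_bigr => i _; rewrite !gE//; exact: ThetaM.
have := posterior_consistent dens mg g0 gHD HY HTheta HA HB gHE Tthstar supp He.
apply: filterS => w; apply: cvg_trans; apply: near_eq_cvg; apply: nearW => n.
rewrite /posterior; congr (_ / _)%E; apply: eq_integral => th.
  by rewrite inE => -[Tth _]; rewrite likE.
by rewrite inE => Tth; rewrite likE.
Qed.
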